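(* The internal operad construction $\mathcal{A}\mapsto\mathcal{I}_{\mathcal{A}}$ is left adjoint to the functor from the category of closed symmetric operads to the category of extensional $\mathbf{BCI}$-algebras sending $\mathcal{P}$ to $\mathcal{P}(0)$.
   Context: Applicative structure: a set with binary application written by juxtaposition, left associative; $a\circ b:=\mathbf{B}\,a\,b$. An extensional $\mathbf{BCI}$-algebra has elements $\mathbf{B},\mathbf{C},\mathbf{I}$ with, for all $a,b,c$: $\mathbf{B}\,a\,b\,c=a\,(b\,c)$; $\mathbf{C}\,a\,b\,c=a\,c\,b$; $\mathbf{I}\,a=a$; $\mathbf{B}\,\mathbf{I}=\mathbf{I}$; $\mathbf{C}\,\mathbf{B}\,\mathbf{I}=\mathbf{I}$; $(\mathbf{B}\,\mathbf{B})\circ\mathbf{B}=(\mathbf{C}\,\mathbf{B}\,\mathbf{B})\circ(\mathbf{B}\circ\mathbf{B})$; $\mathbf{C}\circ\mathbf{C}=\mathbf{I}$; $(\mathbf{B}\,\mathbf{C})\circ(\mathbf{B}\circ\mathbf{B})=(\mathbf{C}\,\mathbf{B}\,\mathbf{C})\circ(\mathbf{B}\circ\mathbf{B})$; $(\mathbf{B}\,\mathbf{C})\circ(\mathbf{C}\circ(\mathbf{B}\,\mathbf{C}))=\mathbf{C}\circ((\mathbf{B}\,\mathbf{C})\circ\mathbf{C})$; $(\mathbf{B}\,\mathbf{B})\circ\mathbf{C}=\mathbf{C}\circ((\mathbf{B}\,\mathbf{C})\circ\mathbf{B})$. Morphisms preserve application, $\mathbf{B},\mathbf{C},\mathbf{I}$.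 Put $a^\bullet=\mathbf{C}\,\mathbf{I}\,a$, $\mathbf{B}^0=\mathbf{I}$, $\mathbf{B}^{k+1}=\mathbf{B}\circ\mathbf{B}^k$ ($\circ$ is associative with unit $\mathbf{I}$). Internal operad: $\mathcal{I}_{\mathcal{A}}(m)=\{a^\bullet\circ\mathbf{B}^m\mid a\in\mathcal{A}\}$, identity $\mathbf{I}$, $\mathbf{app}=\mathbf{B}$, $g(f_1,\dots,f_n)=f_1\circ(\mathbf{B}\,f_2)\circ\cdots\circ(\mathbf{B}^{n-1}f_n)\circ g$; it carries a closed symmetric operad structure. A symmetric operad: an operad with right actions of the symmetric groups $S_j$ on $\mathcal{P}(j)$ satisfying the standard equivariance conditions $(fs)(g_1,\dots,g_k)=(f(g_{s^{-1}(1)},\dots,g_{s^{-1}(k)}))\,s[j_1,\dots,j_k]$ and $f(g_1t_1,\dots,g_kt_k)=(f(g_1,\dots,g_k))(t_1\oplus\dots\oplus t_k)$. Closed: $\mathbf{app}\in\mathcal{P}(2)$ such that each $p\in\mathcal{P}(n+1)$ has a unique $\lambda(p)\in\mathcal{P}(n)$ with $\mathbf{app}(\lambda(p),\mathit{id})=p$. Morphisms of closed symmetric operads preserve identity, composition, symmetric actions and $\mathbf{app}$. $\mathcal{P}(0)$ is an extensional $\mathbf{BCI}$-algebra with $a\,b=\mathbf{app}(a,b)$ and combinators obtained by $\lambda$-abstraction ($\mathbf{I}=\lambda(\mathit{id})$, $\mathbf{B}=\lambda\lambda\lambda(\mathbf{app}(\mathit{id},\mathbf{app}))$, $\mathbf{C}$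 the triple abstraction of $(x,y,z)\mapsto x\,z\,y$). *)

(* Defs.v *)
From mathcomp Require Import all_boot all_order all_fingroup.
From mathcomp Require Import boolp.

Set Implicit Arguments.
Unset Strict Implicit.
Unset Printing Implicit Defensive.

(** * Categories, functors, adjunctions *)

Record category := Category {
  obj :> Type;
  hom : obj -> obj -> Type;
  idm : forall a, hom a a;
  compm : forall a b c, hom b c -> hom a b -> hom a c;
  compm1 : forall a b (f : hom a b), compm f (idm a) = f;
  comp1m : forall a b (f : hom a b), compm (idm b) f = f;
  compmA : forall a b c d (h : hom c d) (g : hom b c) (f : hom a b),
    compm h (compm g f) = compm (compm h g) f }.

Record functor (C D : category) := Functor {
  fobj :> C -> D;
  fmap : forall a b, hom a b -> hom (fobj a) (fobj b);
  fmap1 : forall a, fmap (idm a) = idm (fobj a);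
  fmapM : forall a b c (g : hom b c) (f : hom a b),
    fmap (compm g f) = compm (fmap g) (fmap f) }.

Definition left_adjoint (C D : category) (F : functor C D) (G : functor D C)
  : Prop :=
  exists phi : forall (c : C) (d : D), hom (F c) d -> hom c (G d),
    [/\ forall c d, bijective (@phi c d),
        forall (c c' : C) (d : D) (u : hom c' c) (f : hom (F c) d),
          phi c' d (compm f (fmap F u)) = compm (phi c d f) u
      & forall (c : C) (d d' : D) (v : hom d d') (f : hom (F c) d),
          phi c d' (compm v f) = compm (fmap G v) (phi c d f)].

(** * Extensional BCI-algebras *)

Record bci_ops := BciOps {
  bcar :> Type;
  bapp : bcar -> bcar -> bcar;
  cB : bcar;
  cC : bcar;
  cI : bcar }.

Arguments cB {_}.
Arguments cC {_}.
Arguments cI {_}.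

Declare Scope bci_scope.
Delimit Scope bci_scope with bci.
Notation "a · b" := (bapp a b) (at level 38, left associativity) : bci_scope.
Notation "a ∘ b" := (bapp (bapp cB a) b)
  (at level 42, right associativity) : bci_scope.
Local Open Scope bci_scope.

Record ext_bci (A : bci_ops) : Prop := ExtBci {
  bciB : forall a b c : A, cB · a · b · c = a · (b · c);
  bciC : forall a b c : A, cC · a · b · c = a · c · b;
  bciI : forall a : A, cI · a = a;
  bciBI : cB · cI = cI :> A;
  bciCBI : cC · cB · cI = cI :> A;
  bciBB : (cB · cB) ∘ cB = (cC · cB · cB) ∘ (cB ∘ cB) :> A;
  bciCC : cC ∘ cC = cI :> A;
  bciBC : (cB · cC) ∘ (cB ∘ cB) = (cC · cB · cC) ∘ (cB ∘ cB) :> A;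
  bciYB : (cB · cC) ∘ (cC ∘ (cB · cC)) = cC ∘ ((cB · cC) ∘ cC) :> A;
  bciBBC : (cB · cB) ∘ cC = cC ∘ ((cB · cC) ∘ cB) :> A }.

Record bci_algebra := BciAlgebra {
  bci_base :> bci_ops;
  bciP : ext_bci bci_base }.

Record bci_hom (A A' : bci_ops) := BciHom {
  bfun :> A -> A';
  bfun_app : forall a b, bfun (a · b) = bfun a · bfun b;
  bfunB : bfun cB = cB;
  bfunC : bfun cC = cC;
  bfunI : bfun cI = cI }.

Lemma bci_hom_eq (A A' : bci_ops) (f g : bci_hom A A') :
  (forall x, f x = g x) -> f = g.
Proof.
case: f g => [f f1 f2 f3 f4] [g g1 g2 g3 g4] /= /funext e.
move: f1 f2 f3 f4; rewrite e => f1 f2 f3 f4.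
by congr BciHom; apply: Prop_irrelevance.
Qed.

Definition bci_id (A : bci_ops) : bci_hom A A :=
  @BciHom A A id (fun _ _ => erefl) erefl erefl erefl.

Definition bci_comp (A A' A'' : bci_ops) (g : bci_hom A' A'')
  (f : bci_hom A A') : bci_hom A A''.
Proof.
exists (fun x => g (f x)) => [a b|||].
- by rewrite !bfun_app.
- by rewrite !bfunB.
- by rewrite !bfunC.
- by rewrite !bfunI.
Defined.

Definition bci_category : category.
Proof.
exists bci_algebra (fun A A' => bci_hom A A') (fun A => bci_id A)
  (fun A A' A'' => @bci_comp A A' A'').
- by move=> *; apply: bci_hom_eq.
- by move=> *; apply: bci_hom_eq.
- by move=> *; apply: bci_hom_eq.
Defined.

(** * Closed symmetric operads *)

(** [sum_perm t] is the permutation t_1 (+) ... (+) t_n of the disjoint sum of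
    blocks of sizes [k i]; [tagnat.Rank] numbers the pairs (block, position)
    in lexicographic order. *)
Section BlockPermutations.
Variables (n : nat) (k : 'I_n -> nat).

Definition sum_perm_fun (t : forall i, 'S_(k i)) (x : 'I_(\sum_i k i)) :
  'I_(\sum_i k i) :=
  @tagnat.Rank n k (tagnat.sig1 x) (t (tagnat.sig1 x) (tagnat.sig2 x)).

Lemma sum_perm_inj t : injective (sum_perm_fun t).
Proof.
move=> x y e; rewrite -(tagnat.sig2K x) -(tagnat.sig2K y).
move: e; rewrite /sum_perm_fun.
move: (tagnat.sig1 x) (tagnat.sig2 x) (tagnat.sig1 y) (tagnat.sig2 y).
move=> i a j b /tagnat.rank_inj e.
have eij : i = j := congr1 tag e.
case: j / eij b e => b /eqP; rewrite eq_Tagged /= => /eqP/perm_inj -> //.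
Qed.

Definition sum_perm (t : forall i, 'S_(k i)) : 'S_(\sum_i k i) :=
  perm (@sum_perm_inj t).

Variable s : 'S_n.

Lemma block_sumE : \sum_i k (s^-1%g i) = \sum_i k i.
Proof. exact/esym/(reindex_inj (@perm_inj _ s^-1%g)). Qed.

(** [block_perm] is s[k_1, ..., k_n]: position [q] of the [i]-th block, for
    the block sizes [k], goes to position [q] of block [s i] for the permuted
    block sizes [k \o s^-1]. *)
Definition block_perm_fun (x : 'I_(\sum_i k i)) : 'I_(\sum_i k i) :=
  let i := tagnat.sig1 x in
  cast_ord block_sumE
    (@tagnat.Rank n (fun i => k (s^-1%g i)) (s i)
       (cast_ord (congr1 k (esym (permK s i))) (tagnat.sig2 x))).

Lemma block_perm_inj : injective block_perm_fun.
Proof.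
move=> x y /cast_ord_inj e; rewrite -(tagnat.sig2K x) -(tagnat.sig2K y).
move: e; move: (tagnat.sig1 x) (tagnat.sig2 x) (tagnat.sig1 y) (tagnat.sig2 y).
move=> i a j b /= /(congr1 val)/eqP; rewrite tagnat.eq_Rank /=.
case/andP => /eqP/perm_inj eij; case: j / eij b => b /eqP/val_inj.
by move=> ->.
Qed.

Definition block_perm : 'S_(\sum_i k i) := perm block_perm_inj.

End BlockPermutations.

(** Operations of a given arity with their arity: the arguments of an operadic
    composition g(f_1, ..., f_n) form a family ['I_n -> total P]. *)
Definition total (P : nat -> Type) := {m : nat & P m}.

Definition tot (P : nat -> Type) m (x : P m) : total P := Tagged P x.

Definition opcast (P : nat -> Type) m n (e : m = n) (x : P m) : P n :=
  ecast i (P i) e x.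

Definition pair_args (P : nat -> Type) (a b : total P) (i : 'I_2) : total P :=
  if i == ord0 then a else b.

Record operad_ops := OperadOps {
  ocar :> nat -> Type;
  oid : ocar 1;
  ocomp : forall n, ocar n -> forall a : 'I_n -> total ocar,
    ocar (\sum_i tag (a i));
  oact : forall n, ocar n -> 'S_n -> ocar n;
  oapp : ocar 2;
  olam : forall n, ocar n.+1 -> ocar n }.

Arguments oid {_}.
Arguments oapp {_}.

Lemma sum_pair_args (P : nat -> Type) m n (a : P m) (b : P n) :
  \sum_i tag (pair_args (tot a) (tot b) i) = m + n.
Proof. by rewrite big_ord_recl big_ord1. Qed.

Definition ocomp2 (P : operad_ops) m n (g : P 2) (a : P m) (b : P n) :
  P (m + n) :=
  opcast (sum_pair_args a b) (ocomp g (pair_args (tot a) (tot b))).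

(** Equations between operations whose arities are only propositionally equal
    are stated in [total P]; such an equation entails that of the arities.

    The right action law is for the product of S_n given by composition of
    functions, st = s \o t, as forced by [eqv_outer]; the product of
    permutations in the library is (t * s) i = s (t i), hence the order in
    [oactM]. *)
Record closed_symmetric_operad_axioms (P : operad_ops) : Prop :=
  ClosedSymmetricOperadAxioms {
  ocomp_idl : forall m (f : P m), tot (ocomp oid (fun=> tot f)) = tot f;
  ocomp_idr : forall n (f : P n), tot (ocomp f (fun=> tot oid)) = tot f;
  ocompA : forall n (h : P n) (g : 'I_n -> total P)
      (f : forall i, 'I_(tag (g i)) -> total P),
    tot (ocomp (ocomp h g)
           (fun x => f (tagnat.sig1 x) (tagnat.sig2 x)))
    = tot (ocomp h (fun i => tot (ocomp (tagged (g i)) (f i))));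
  oact1 : forall n (f : P n), oact f 1%g = f;
  oactM : forall n (f : P n) (s t : 'S_n),
    oact f (t * s)%g = oact (oact f s) t;
  eqv_outer : forall n (f : P n) (s : 'S_n) (g : 'I_n -> total P),
    ocomp (oact f s) g
    = oact (opcast (block_sumE (fun i => tag (g i)) s)
              (ocomp f (fun i => g (s^-1%g i))))
           (block_perm (fun i => tag (g i)) s);
  eqv_inner : forall n (f : P n) (g : 'I_n -> total P)
      (t : forall i, 'S_(tag (g i))),
    ocomp f (fun i => tot (oact (tagged (g i)) (t i)))
    = oact (ocomp f g) (sum_perm t);
  olamK : forall n (p : P n.+1), tot (ocomp2 oapp (olam p) oid) = tot p;
  olam_uniq : forall n (p : P n.+1) (q : P n),
    tot (ocomp2 oapp q oid) = tot p -> q = olam p }.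

Record operad := Operad {
  operad_base :> operad_ops;
  operadP : closed_symmetric_operad_axioms operad_base }.

Record operad_hom (P Q : operad_ops) := OperadHom {
  ofun :> forall n, P n -> Q n;
  ofun_id : ofun oid = oid;
  ofun_comp : forall n (g : P n) (a : 'I_n -> total P),
    ofun (ocomp g a) = ocomp (ofun g) (fun i => tot (ofun (tagged (a i))));
  ofun_act : forall n (f : P n) (s : 'S_n), ofun (oact f s) = oact (ofun f) s;
  ofun_app : ofun oapp = oapp }.

Lemma operad_hom_eq (P Q : operad_ops) (f g : operad_hom P Q) :
  (forall n x, f n x = g n x) -> f = g.
Proof.
case: f g => [f f1 f2 f3 f4] [g g1 g2 g3 g4] /= h.
have e : f = g.
  by apply: functional_extensionality_dep => n; apply: funext => x; apply: h.
move: f1 f2 f3 f4; rewrite e => f1 f2 f3 f4.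
by congr OperadHom; apply: Prop_irrelevance.
Qed.

Definition operad_id (P : operad_ops) : operad_hom P P.
Proof.
exists (fun n x => x) => // n g a.
have e : a = (fun i => tot (tagged (a i))).
  by apply: funext => i; case: (a i).
exact: eq_from_Tagged (congr1 (fun b => tot (ocomp g b)) e).
Defined.

Definition operad_comp (P Q R : operad_ops) (g : operad_hom Q R)
  (f : operad_hom P Q) : operad_hom P R.
Proof.
exists (fun n x => g n (f n x)) => [|n h a|n h s|].
- by rewrite (ofun_id f) (ofun_id g).
- exact: etrans (congr1 (g _) (ofun_comp f h a))
    (ofun_comp g (f n h) (fun i => tot (f _ (tagged (a i))))).
- by rewrite (ofun_act f) (ofun_act g).
- by rewrite (ofun_app f) (ofun_app g).
Defined.

Definition operad_category : category.
Proof.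
exists operad (fun P Q => operad_hom P Q) (fun P => operad_id P)
  (fun P Q R => @operad_comp P Q R).
- by move=> *; apply: operad_hom_eq.
- by move=> *; apply: operad_hom_eq.
- by move=> *; apply: operad_hom_eq.
Defined.

(** * The functor P |-> P(0) *)

Definition op_I (P : operad_ops) : P 0 := olam oid.

Definition op_B (P : operad_ops) : P 0 :=
  @olam P 0 (@olam P 1 (@olam P 2 (ocomp2 oapp oid oapp))).

(** (x, y, z) |-> x z y is (x, y, z) |-> x y z acted on by the transposition of
    the last two of the three variables. *)
Definition op_C (P : operad_ops) : P 0 :=
  @olam P 0 (@olam P 1 (@olam P 2
    (@oact P 3 (ocomp2 oapp oapp oid)
       (tperm (inord 1 : 'I_3) (inord 2 : 'I_3))))).

Definition global_ops (P : operad_ops) : bci_ops :=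
  @BciOps (P 0) (fun a b => ocomp2 oapp a b) (op_B P) (op_C P) (op_I P).

Section GlobalHom.
Variables (P Q : operad) (h : operad_hom P Q).

Lemma opcast_comp n (g : Q n) (a a' : 'I_n -> total Q) m
  (e : \sum_i tag (a i) = m) (e' : \sum_i tag (a' i) = m) :
  a = a' -> opcast e (ocomp g a) = opcast e' (ocomp g a').
Proof.
move=> eaa'; move: e e'; rewrite eaa' => e e'.
by rewrite (eq_irrelevance e e').
Qed.

Lemma ofun_opcast m n (e : m = n) (x : P m) :
  h n (opcast e x) = opcast e (h m x).
Proof. by case: n / e. Qed.

Lemma ofun_comp2 m n (g : P 2) (a : P m) (b : P n) :
  h (m + n) (ocomp2 g a b) = ocomp2 (h 2 g) (h m a) (h n b).
Proof.
rewrite /ocomp2 ofun_opcast ofun_comp.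
pose c i : total Q := tot (h _ (tagged (pair_args (tot a) (tot b) i))).
have e : c = pair_args (tot (h m a)) (tot (h n b)).
  by apply: funext => i; rewrite /c /pair_args; case: ifP.
exact: (@opcast_comp 2 (h 2 g) c _ (m + n) (sum_pair_args a b) _ e).
Qed.

Lemma tot_ofun m n (x : P m) (y : P n) :
  tot x = tot y -> tot (h m x) = tot (h n y).
Proof. by move=> /(congr1 (fun u : total P => tot (h _ (tagged u)))). Qed.

Lemma ofun_lam n (p : P n.+1) : h n (olam p) = olam (h n.+1 p).
Proof.
apply: (olam_uniq (operadP Q)).
rewrite -(ofun_app h) -(ofun_id h) -ofun_comp2; apply: tot_ofun.
exact: olamK (operadP P) _ _.
Qed.

Definition global_hom : bci_hom (global_ops P) (global_ops Q).
Proof.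
exists (h 0) => [a b|||] /=.
- by rewrite (@ofun_comp2 0 0) ofun_app.
- by rewrite /op_B !ofun_lam (@ofun_comp2 1 2) ofun_id ofun_app.
- by rewrite /op_C !ofun_lam ofun_act (@ofun_comp2 2 1) ofun_id ofun_app.
- by rewrite /op_I ofun_lam ofun_id.
Defined.

End GlobalHom.

Definition global_functor (ax : forall P : operad, ext_bci (global_ops P)) :
  functor operad_category bci_category.
Proof.
exists (fun P : operad_category => BciAlgebra (ax P) : bci_category)
  (fun P Q h => global_hom h).
- by move=> P; apply: bci_hom_eq.
- by move=> P Q R g f; apply: bci_hom_eq.
Defined.

(** * The internal operad *)

Definition bullet (A : bci_ops) (a : A) : A := cC · cI · a.

Definition Bpow (A : bci_ops) (n : nat) : A := iter n (fun x => cB ∘ x) cI.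

Arguments Bpow {A}.

Definition internal_car (A : bci_ops) (m : nat) : Type :=
  {x : A | exists a : A, x = bullet a ∘ Bpow m}.

(** The closed symmetric operad structure on the sets [internal_car A m]. The
    equations determine it uniquely: adjacent transpositions generate the
    symmetric groups, and [int_lam] is fixed by uniqueness of abstractions.
    Since (bullet a ∘ B^m) x y_0 ... y_(m-1) = x (a y_0 ... y_(m-1)), exchanging
    y_i and y_(i+1) in [f] amounts to composing B^i C with [f]. The iterated
    operation in [int_compE] is f_1 ∘ (B f_2) ∘ ... ∘ (B^(n-1) f_n) ∘ g,
    with the f_i numbered from 0. *)
Record internal_structure (A : bci_ops) := InternalStructure {
  int_id : internal_car A 1;
  int_comp : forall n, internal_car A n ->
    forall f : 'I_n -> total (internal_car A),
    internal_car A (\sum_i tag (f i));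
  int_act : forall n, internal_car A n -> 'S_n -> internal_car A n;
  int_app : internal_car A 2;
  int_lam : forall n, internal_car A n.+1 -> internal_car A n;
  int_idE : sval int_id = cI;
  int_compE : forall n (g : internal_car A n)
      (f : 'I_n -> total (internal_car A)),
    sval (int_comp g f)
    = \big[(fun x y : A => x ∘ y)/sval g]_(i < n)
        (Bpow i · sval (tagged (f i)));
  int_actE : forall n (f : internal_car A n) (i j : 'I_n), j = i.+1 :> nat ->
    sval (int_act f (tperm i j)) = (Bpow i · cC) ∘ sval f;
  int_appE : sval int_app = cB;
  int_closed : closed_symmetric_operad_axioms
    (OperadOps int_id int_comp int_act int_app int_lam) }.

Definition internal_operad (A : bci_ops) (S : internal_structure A) : operad :=
  Operad (int_closed S).

Section InternalHom.
Variables (A A' : bci_ops) (h : bci_hom A A').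

Lemma bfun_bullet a : h (bullet a) = bullet (h a).
Proof. by rewrite /bullet !bfun_app bfunC bfunI. Qed.

Lemma bfun_comp a b : h (a ∘ b) = h a ∘ h b.
Proof. by rewrite !bfun_app bfunB. Qed.

Lemma bfun_Bpow n : h (Bpow n) = Bpow n.
Proof. by elim: n => [|n IH]; rewrite ?bfunI //= bfun_comp bfunB IH. Qed.

Lemma internal_map_proof m (x : internal_car A m) :
  exists a : A', h (sval x) = bullet a ∘ Bpow m.
Proof.
case: (svalP x) => a ->; exists (h a).
by rewrite bfun_comp bfun_bullet bfun_Bpow.
Qed.

Definition internal_map m (x : internal_car A m) : internal_car A' m :=
  exist _ (h (sval x)) (internal_map_proof x).

Lemma sval_inj (T : Type) (R : T -> Prop) : injective (@sval T R).
Proof. by move=> [x p] [y q] /= e; apply: eq_exist. Qed.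

Lemma perm_adjacent_ind n (R : 'S_n -> Prop) :
    R 1%g -> (forall s t, R s -> R t -> R (s * t)%g) ->
    (forall i j : 'I_n, j = i.+1 :> nat -> R (tperm i j)) ->
  forall s, R s.
Proof.
move=> R1 RM Ra.
have Rlt d : forall i j : 'I_n, j = i + d :> nat -> R (tperm i j).
  elim: d => [|d IH] i j ej.
    by rewrite (_ : j = i) ?tperm1 //; apply: val_inj; rewrite /= ej addn0.
  have lk : i + d < n.
    by apply: leq_ltn_trans (ltn_ord j); rewrite ej addnS.
  pose k : 'I_n := Ordinal lk.
  have Rk : R (tperm k j) by apply: Ra; rewrite ej addnS.
  have Ri : R (tperm i k) by apply: IH.
  have [->|nij] := eqVneq i k; first exact: Rk.
  have -> : tperm i j = (tperm k j * (tperm i k * tperm k j))%g.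
    rewrite -{1}(tpermV k j) -/(conjg _ _) tpermJ tpermL tpermD //.
      by rewrite eq_sym.
    by rewrite -val_eqE /= ej gtn_eqF // addnS ltnS leq_addr.
  by apply: (RM) => //; apply: RM.
have Rt i j : R (tperm i j).
  have [le|/ltnW le] := leqP i j; first by apply: (Rlt (j - i)); rewrite subnKC.
  by rewrite tpermC; apply: (Rlt (i - j)); rewrite subnKC.
move=> s; have [ts -> _] := prod_tpermP s.
by elim: ts => [|t ts IH]; rewrite ?big_nil ?big_cons //; apply: RM.
Qed.

Variables (S : internal_structure A) (S' : internal_structure A').

Definition internal_hom :
  operad_hom (internal_operad S) (internal_operad S').
Proof.
exists internal_map => [|n g a|n f s|].
- by apply: sval_inj; rewrite /= !int_idE bfunI.
- apply: sval_inj; rewrite /= int_compE.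
  rewrite (@big_morph _ _ h (h (sval g)) (fun x y => x ∘ y) _ _ bfun_comp)
    //.
  rewrite (int_compE S' (internal_map g)
    (fun i => tot (internal_map (tagged (a i))))).
  by apply: eq_bigr => i _; rewrite bfun_app bfun_Bpow.
- move: s f; apply: perm_adjacent_ind => [f|s t IHs IHt f|i j eij f].
  + by rewrite (oact1 (int_closed S)) (oact1 (int_closed S')).
  + by rewrite (oactM (int_closed S)) (oactM (int_closed S')) /= IHs IHt.
  + apply: sval_inj; rewrite /= !int_actE //.
    by rewrite bfun_comp bfun_app bfun_Bpow bfunC.
- by apply: sval_inj; rewrite /= !int_appE bfunB.
Defined.

End InternalHom.

(** The internal operad construction on objects is [internal_operad (S A)], and
    a homomorphism is sent to its restrictions to the sets [internal_car]. *)
Definition internal_functor (S : forall A : bci_algebra, internal_structure A) :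
  functor bci_category operad_category.
Proof.
exists (fun A : bci_category => internal_operad (S A) : operad_category)
  (fun A A' h => internal_hom h (S A) (S A')).
- by move=> A; apply: operad_hom_eq => n x; apply: sval_inj.
- by move=> A B C g f; apply: operad_hom_eq => n x; apply: sval_inj.
Defined.

(* Main.v *)
(** Write [x ∘ y] for composition in [A] and [B x] for the shift of [x]. The
    extensionality axioms include B : 2 -> 1 and C : 2 -> 2, where [x : m -> n]
    stands for the equation [(B x) ∘ B^n = x• ∘ B^(m+1)], which entails
    [x ∘ B^n z = B^m z ∘ x] for all [z]. These arrows are closed under composition
    and shift, and the arrows [m -> 1] are the operations of arity [m]: such an
    [x] is [(x I)• ∘ B^m]. Hence I(m) is in bijection with [A], and abstraction
    I(m+1) -> I(m) leaves [x I] unchanged. A permutation acts through the product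
    of the B^i C given by its Lehmer code, which makes the Coxeter relations and
    the two equivariance laws inductions on words.

    For an operad [P], operations with labelled inputs, up to permutation of the
    inputs, are linear terms. On them B, C and I satisfy their laws, and a closed
    operation is determined by its value at distinct variables; each axiom for
    P(0) then follows by applying both sides to enough variables.

    The unit sends [a] to [a•] in I(0), which is bijective. A homomorphism
    [h : A -> P(0)] extends to I by sending [x] in I(m) to the m-fold uncurrying
    of [h (x I)]; that this preserves the structure is again checked on
    variables. *)
From mathcomp Require Import all_boot all_order all_fingroup.
From mathcomp Require Import boolp.
Require Import Defs.

Set Implicit Arguments.
Unset Strict Implicit.
Unset Printing Implicit Defensive.

Local Open Scope bci_scope.

(** * Elements of a BCI-algebra as arrows *)

Section BciCalculus.
Variable A : bci_algebra.
Implicit Types a x y : A.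

(** [cmp] and [sh] keep rewriting with laws about [cB · _] from matching inside
    [_ ∘ _], which is itself [cB · _ · _]. *)
Definition cmp a b : A := a ∘ b.
Definition sh a : A := cB · a.

Let axA := bciP A.

Lemma cmpE a b c : cmp a b · c = a · (b · c).
Proof. exact: bciB axA _ _ _. Qed.

Lemma shE a b : sh a · b = cmp a b.
Proof. by []. Qed.

Lemma cmp1x x : cmp cI x = x.
Proof. by rewrite /cmp (bciBI axA) (bciI axA). Qed.

Lemma sh1 : sh cI = cI.
Proof. exact: bciBI axA. Qed.

Lemma bulletE x a : bullet a · x = x · a.
Proof. by rewrite /bullet (bciC axA) (bciI axA). Qed.

Lemma cmpx1 x : cmp x cI = x.
Proof. by rewrite -[RHS](bciI axA) -[in RHS](bciCBI axA) (bciC axA). Qed.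

(** This is [bciBB] evaluated at [a]. Evaluating again gives [sh_cmp], and once more gives
    associativity [cmpA]. *)
Lemma B_sh a : cmp cB (sh a) = cmp (sh (sh a)) cB.
Proof.
have : cmp (sh cB) cB · a = cmp (cC · cB · cB) (cmp cB cB) · a.
  exact: (f_equal (fun u : A => u · a) (bciBB axA)).
by rewrite !cmpE (bciC axA).
Qed.

Lemma sh_cmp a b : sh (cmp a b) = cmp (sh a) (sh b).
Proof. by have := congr1 (fun u : A => u · b) (B_sh a); rewrite !cmpE. Qed.

Lemma cmpA a b c : cmp (cmp a b) c = cmp a (cmp b c).
Proof. by have := congr1 (fun u : A => u · c) (sh_cmp a b); rewrite !cmpE. Qed.

Lemma CC : cmp cC cC = cI :> A.
Proof. exact: bciCC axA. Qed.

Lemma CCK x : cmp cC (cmp cC x) = x.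
Proof. by rewrite -cmpA CC cmp1x. Qed.

Lemma C_sh2 a : cmp cC (sh (sh a)) = cmp (sh (sh a)) cC.
Proof.
have : cmp (sh cC) (cmp cB cB) · a = cmp (cC · cB · cC) (cmp cB cB) · a.
  exact: (f_equal (fun u : A => u · a) (bciBC axA)).
by rewrite !cmpE (bciC axA).
Qed.

Lemma braid : cmp (sh cC) (cmp cC (sh cC)) = cmp cC (cmp (sh cC) cC) :> A.
Proof. exact: bciYB axA. Qed.

Lemma shB_C : cmp (sh cB) cC = cmp cC (cmp (sh cC) cB) :> A.
Proof. exact: bciBBC axA. Qed.

Lemma C_shB : cmp cC (sh cB) = cmp (sh cC) (cmp cB cC) :> A.
Proof.
have e : cmp cC (cmp (sh cB) cC) = cmp (sh cC) cB by rewrite shB_C CCK.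
by rewrite -cmpA -e !cmpA CC cmpx1.
Qed.

(** The law [shB_C] applied to I, [a] and [x]. It turns C B B and C B C in the axioms into B• ∘ B
    and C• ∘ B. *)
Lemma bullet_cmp a x : cmp (bullet a) x = cC · x · a.
Proof.
have := congr1 (fun u : A => u · cI · a · x) shB_C.
by rewrite !cmpE (bciC axA) shE cmpE (bciBI axA) (bciI axA).
Qed.

Lemma C_cmp_CI b : cC · (cmp (cC · cI) b) = cC · cB · b.
Proof.
have := congr1 (fun u => u · cI) C_shB.
by rewrite !cmpE shE cmpx1 => ->; rewrite cmpE.
Qed.

Lemma bullet_sh a x : cmp (bullet a) (sh x) = cmp x (bullet a).
Proof.
have := congr1 (fun u => u · cI · a) (C_sh2 x).
by rewrite !cmpE !shE cmpx1 bullet_cmp.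
Qed.

(** By [C_cmp_CI] the right-hand side is C (C (C I ∘ b)) a, and C ∘ C = I leaves C I (b a). *)
Lemma bullet_app a b : bullet (b · a) = cmp (bullet a) (cmp (bullet b) cB).
Proof.
by rewrite !bullet_cmp -C_cmp_CI -[cC · (cC · _)]cmpE CC (bciI axA) cmpE.
Qed.

Lemma bulletI_B : cmp (bullet cI) cB = cI.
Proof. by rewrite bullet_cmp (bciCBI axA). Qed.

Lemma sh_bullet a : sh (bullet a) = cmp (bullet a) cC.
Proof.
have := congr1 (fun u => u · cI · a) shB_C.
by rewrite !cmpE !shE (bciBI axA) cmpx1 bullet_cmp.
Qed.

(** Locked, so that [cmpA] does not see [Bpow n.+1] as a composite. *)
Definition pw n : A := locked (Bpow n).

Lemma pwE n : pw n = Bpow n.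
Proof. by rewrite /pw -lock. Qed.

Lemma pw0 : pw 0 = cI.
Proof. exact: pwE. Qed.

Lemma pwS n : pw n.+1 = cmp cB (pw n).
Proof. by rewrite !pwE. Qed.

Lemma pw1 : pw 1 = cB.
Proof. by rewrite pwS pw0 cmpx1. Qed.

Lemma pwD m n : pw (m + n) = cmp (pw m) (pw n) :> A.
Proof. by elim: m => [|m IH]; rewrite ?pw0 ?cmp1x // addSn !pwS IH cmpA. Qed.

Lemma pwSr n : pw n.+1 = cmp (pw n) cB :> A.
Proof. by rewrite -addn1 pwD pwS pw0 cmpx1. Qed.

Definition shn n x : A := iter n sh x.

Lemma pw_app n x : pw n · x = shn n x.
Proof. by elim: n => [|n IH]; rewrite ?pw0 ?(bciI axA) // pwS cmpE IH. Qed.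

Lemma shnS n x : shn n.+1 x = sh (shn n x).
Proof. by []. Qed.

Lemma shn0 x : shn 0 x = x.
Proof. by []. Qed.

Lemma shnSr n x : shn n.+1 x = shn n (sh x).
Proof. exact: iterSr. Qed.

Lemma shn_cmp n x y : shn n (cmp x y) = cmp (shn n x) (shn n y).
Proof. by elim: n => // n IH; rewrite !shnS IH sh_cmp. Qed.

Lemma shn_id n : shn n cI = cI.
Proof. by elim: n => // n IH; rewrite shnS IH sh1. Qed.

(** * Arrows and their closure properties *)

(** [arr m n x] says that [x] takes [m] arguments to [n] values, in the sense
    of [arr_sh] below, but as a single equation between elements. *)
Definition arr m n x := cmp (sh x) (pw n) = cmp (bullet x) (pw m.+1).

Lemma arr_sh m n x z : arr m n x -> cmp x (shn n z) = cmp (shn m z) x.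
Proof.
move=> /(congr1 (fun u => u · z)).
by rewrite !cmpE !pw_app shE bulletE.
Qed.

(** Compose the arrow equation with I• on the left and use I• ∘ B x = x ∘ I• and I• ∘ B = I. *)
Lemma arr_opE m x : arr m 1 x -> x = cmp (bullet (x · cI)) (pw m).
Proof.
move=> /(congr1 (cmp (bullet cI))).
rewrite -!cmpA bullet_sh cmpA pw1 bulletI_B cmpx1 => e.
by rewrite [LHS]e bullet_app pwS -!cmpA.
Qed.

Lemma arr_id m : arr m m cI.
Proof. by rewrite /arr sh1 cmp1x pwS -cmpA bulletI_B cmp1x. Qed.

Lemma arr_B : arr 2 1 cB.
Proof.
have e : cmp (sh cB) cB = cmp (cC · cB · cB) (cmp cB cB) by exact: (bciBB axA).
by rewrite /arr !pwS !pw0 !cmpx1 e -bullet_cmp -!cmpA.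
Qed.

Lemma arr_C : arr 2 2 cC.
Proof.
have e : cmp (sh cC) (cmp cB cB) = cmp (cC · cB · cC) (cmp cB cB).
  exact: (bciBC axA).
by rewrite /arr !pwS !pw0 !cmpx1 e -bullet_cmp -!cmpA.
Qed.

(** The arrow equation of B lets B pass a bullet; composites and shifts of arrows both need this. *)
Lemma B_bullet x m :
  cmp cB (cmp (bullet x) (pw m.+1)) = cmp (bullet (sh x)) (pw m.+2).
Proof.
have eB : cmp (sh cB) cB = cmp (bullet cB) (cmp cB (cmp cB cB)).
  by have := arr_B; rewrite /arr !pwS !pw0 !cmpx1.
by rewrite -cmpA -bullet_sh bullet_app !pwS !cmpA -[cmp (sh cB) _]cmpA eB !cmpA.
Qed.

Lemma arr_cmp m n p x y : arr m n x -> arr n p y -> arr m p (cmp x y).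
Proof.
rewrite /arr => ax ay.
rewrite sh_cmp cmpA ay -cmpA -bullet_sh pwS cmpA -[cmp (sh (sh x)) _]cmpA.
rewrite -B_sh [cmp (cmp cB _) _]cmpA ax B_bullet.
by rewrite -[cmp x y]/(sh x · y) bullet_app (pwS m.+1) !cmpA.
Qed.

Lemma arr_shift m n x : arr m n x -> arr m.+1 n.+1 (sh x).
Proof. by rewrite /arr => ax; rewrite -B_bullet -ax pwS -!cmpA B_sh. Qed.

(** As a• is C I a, its own bullet splits into a•, I• and C•, and the arrow equation of C
    applies. *)
Lemma arr_bullet a : arr 0 1 (bullet a).
Proof.
have := arr_C; rewrite /arr !pwS !pw0 !cmpx1 => e.
rewrite sh_bullet [bullet (bullet a)]bullet_app bullet_app !cmpA -e.
by rewrite -[cmp (bullet cI) _]cmpA bullet_sh !cmpA -[cmp (bullet cI) _]cmpA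
  bulletI_B cmp1x.
Qed.

Lemma arr_widen k m n x : arr m n x -> arr (m + k) (n + k) x.
Proof. by rewrite /arr -addSn !pwD -!cmpA => ->. Qed.

Lemma arr_pw m : arr m.+1 1 (pw m).
Proof.
elim: m => [|m IH]; first by rewrite pw0; apply: arr_id.
rewrite pwS; apply: arr_cmp IH.
by have := arr_widen m arr_B; rewrite !addSn.
Qed.

Lemma arr_op a m : arr m 1 (cmp (bullet a) (pw m)).
Proof.
apply: arr_cmp (arr_pw m).
exact: (arr_widen m (arr_bullet a)).
Qed.

(** * Cycles of arguments *)

(** The element C ∘ B C ∘ ... ∘ B^(k-1) C, which sends f a b_1 ... b_k to f b_1 ... b_k a. *)
Definition cyc k : A := locked (iter k (fun x => cmp cC (sh x)) cI).

Lemma cyc0 : cyc 0 = cI.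
Proof. by rewrite /cyc -lock. Qed.

Lemma cycS k : cyc k.+1 = cmp cC (sh (cyc k)).
Proof. by rewrite /cyc -!lock. Qed.

Lemma arr_cyc k : arr k.+1 k.+1 (cyc k).
Proof.
elim: k => [|k IH]; first by rewrite cyc0; apply: arr_id.
rewrite cycS; apply: arr_cmp (arr_shift IH).
by have := arr_widen k arr_C; rewrite !addSn.
Qed.

Lemma cycD m n : cyc (m + n) = cmp (cyc m) (shn m (cyc n)).
Proof.
elim: m => [|m IH]; first by rewrite cyc0 cmp1x.
by rewrite addSn !cycS IH sh_cmp cmpA.
Qed.

(** Exchanging two adjacent letters of a word turns the Lehmer codes [i], [j] into [j + 1], [i]. The
    induction step is the Yang-Baxter equation [braid]. *)
Lemma cyc_swap i j : i <= j ->
  cmp cC (cmp (sh (cyc j)) (cyc i)) = cmp (sh (cyc i)) (cyc j.+1).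
Proof.
elim: i j => [|i IH] j; first by rewrite cycS cyc0 sh1 cmp1x cmpx1.
case: j => [|j] // le.
have e2 z w : cmp (sh (sh z)) (cmp cC w) = cmp cC (cmp (sh (sh z)) w).
  by rewrite -cmpA -C_sh2 cmpA.
rewrite (cycS j) (cycS i) !sh_cmp !cmpA e2.
rewrite -[cmp cC (cmp (sh cC) _)]cmpA -[cmp (cmp cC _) (cmp cC _)]cmpA.
rewrite [cmp (cmp cC _) cC]cmpA -braid !cmpA; congr (cmp _ _).
by rewrite -!sh_cmp IH // sh_cmp -e2 -cycS.
Qed.

(** An argument that is an application x y moves past [k] others by moving x and y separately. *)
Lemma B_cyc k : cmp cB (cyc k) = cmp (sh (cyc k)) (cmp (cyc k) (shn k cB)).
Proof.
elim: k => [|k IH]; first by rewrite cyc0 sh1 !cmp1x cmpx1.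
have eB : cmp cB cC = cmp (sh cC) (cmp cC (sh cB)).
  by rewrite C_shB -cmpA -sh_cmp CC sh1 cmp1x.
rewrite cycS -cmpA eB !cmpA -!sh_cmp IH !sh_cmp.
by rewrite -[cmp cC (cmp (sh (sh _)) _)]cmpA C_sh2 !cmpA.
Qed.

(** Moving an argument past the output of [h] is moving it past the [n] inputs of [h]. *)
Lemma sh_op_C n h : arr n 1 h -> cmp (sh h) cC = cmp (cyc n) h.
Proof.
have shpw m : cmp (sh (pw m)) cC = cmp (cyc m.+1) (pw m).
  elim: m => [|m IH]; first by rewrite pw0 sh1 cmp1x !cmpx1 cycS cyc0 sh1 cmpx1.
  rewrite pwS sh_cmp cmpA IH [cyc m.+1]cycS -cmpA -[cmp (sh cB) _]cmpA shB_C.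
  by rewrite !cmpA -[cmp cB (cmp (sh _) _)]cmpA B_sh !cycS !sh_cmp !cmpA.
move=> /arr_opE ->; rewrite sh_cmp cmpA shpw cycS sh_bullet cmpA.
by rewrite -[cmp cC (cmp _ _)]cmpA CCK -cmpA bullet_sh cmpA.
Qed.

(** The permutation moving a block of [m] arguments past a block of [k]. *)
Definition block_cyc m k : A :=
  locked (iter m (fun x => cmp (sh x) (cyc k)) cI).

Lemma block_cyc0 k : block_cyc 0 k = cI.
Proof. by rewrite /block_cyc -lock. Qed.

Lemma block_cycS m k :
  block_cyc m.+1 k = cmp (sh (block_cyc m k)) (cyc k).
Proof. by rewrite /block_cyc -!lock. Qed.

(** The output of [g] moves past [k] arguments as the block of its [m] inputs. *)
Lemma op_cyc m k g : arr m 1 g ->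
  cmp g (cyc k) = cmp (block_cyc m k) (shn k g).
Proof.
have pw_cyc n : cmp (pw n) (cyc k) = cmp (block_cyc n.+1 k) (shn k (pw n)).
  elim: n => [|n IH]; first by rewrite pw0 shn_id cmp1x !cmpx1 block_cycS
    block_cyc0 sh1 cmp1x.
  rewrite pwS cmpA IH [block_cyc n.+2 k]block_cycS block_cycS shn_cmp.
  rewrite !sh_cmp -cmpA -[cmp cB _]cmpA B_sh !cmpA.
  by rewrite -[cmp cB (cmp _ _)]cmpA B_cyc !cmpA.
have bullet_cyc a : cmp (bullet a) (cyc k) = shn k (bullet a).
  elim: {pw_cyc} k => [|k' IH]; first by rewrite cyc0 cmpx1.
  by rewrite cycS -cmpA -sh_bullet -sh_cmp IH.
move=> /arr_opE ->; rewrite cmpA pw_cyc block_cycS shn_cmp -!cmpA bullet_sh.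
by rewrite !cmpA -[cmp (bullet _) (cmp (cyc k) _)]cmpA bullet_cyc.
Qed.

(** * Operations side by side *)

(** The composite g_1 ∘ B g_2 ∘ B^2 g_3 ∘ ..., that is, an operadic composition without its outer
    operation. *)
Definition tens (T : Type) (g : T -> A) (l : seq T) : A :=
  foldr (fun i x => cmp (g i) (sh x)) cI l.

Section Tensor.
Variables (T : Type) (g : T -> A) (k : T -> nat).
Hypothesis gP : forall i, arr (k i) 1 (g i).

Lemma tens_cons i l : tens g (i :: l) = cmp (g i) (sh (tens g l)).
Proof. by []. Qed.

Lemma arr_tens l : arr (sumn (map k l)) (size l) (tens g l).
Proof.
elim: l => [|i l IH]; first exact: arr_id.
have := arr_widen (sumn (map k l)) (gP i); rewrite add1n => ai.
exact: arr_cmp ai (arr_shift IH).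
Qed.

Lemma tens_cat l1 l2 :
  tens g (l1 ++ l2) = cmp (tens g l1) (shn (size l1) (tens g l2)).
Proof.
elim: l1 => [|i l1 IH]; first by rewrite cmp1x.
by rewrite cat_cons !tens_cons IH sh_cmp cmpA.
Qed.

Lemma sh_tens_cyc l : cmp (sh (tens g l)) (cyc (size l)) =
  cmp (cyc (sumn (map k l))) (tens g l).
Proof.
elim: l => [|i l IH]; first by rewrite /= cyc0 sh1.
rewrite tens_cons sh_cmp [size _]/= cycS cmpA -[cmp (sh (sh _)) _]cmpA -C_sh2.
rewrite cmpA -sh_cmp IH -cmpA (sh_op_C (gP i)) sh_cmp [sumn _]/= cycD !cmpA.
by congr cmp; rewrite -!cmpA -(arr_sh _ (gP i)).
Qed.

(** The interchange law behind associativity of operadic composition: each [u i] slides past the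
    remaining rows by [arr_sh]. *)
Lemma tens_flatten (I : Type) (F : I -> seq T) (u : I -> A) l :
  (forall i, arr (size (F i)) 1 (u i)) ->
  cmp (tens g (flatten (map F l))) (tens u l) =
  tens (fun i => cmp (tens g (F i)) (u i)) l.
Proof.
move=> uP; elim: l => [|i l IH]; first by rewrite cmp1x.
rewrite /= tens_cat -IH sh_cmp !cmpA; congr cmp.
by rewrite -!cmpA -(arr_sh _ (uP i)).
Qed.

End Tensor.

Lemma eq_in_tens (T : eqType) (g g' : T -> A) l :
  {in l, g =1 g'} -> tens g l = tens g' l.
Proof.
elim: l => //= i l IH e; rewrite e ?mem_head ?IH // => j jl.
by apply: e; rewrite in_cons jl orbT.
Qed.

Lemma tens_map (T T' : Type) (g : T' -> A) (h : T -> T') l :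
  tens g (map h l) = tens (g \o h) l.
Proof. by elim: l => //= i l ->. Qed.

(** * Words and Lehmer codes *)

(** The permutation of arguments that sorts a word with distinct letters, read
    off its Lehmer code. *)
Fixpoint word (w : seq nat) : A :=
  if w is x :: w' then cmp (sh (word w')) (cyc (count (ltn^~ x) w')) else cI.

Lemma word_cons (x : nat) w :
  word (x :: w) = cmp (sh (word w)) (cyc (count (ltn^~ x) w)).
Proof. by []. Qed.

Lemma arr_word w : arr (size w) (size w) (word w).
Proof.
elim: w => [|x w IH]; first exact: arr_id.
apply: arr_cmp (arr_shift IH) _.
have := arr_widen (size w - count (ltn^~ x) w) (arr_cyc (count (ltn^~ x) w)).
by rewrite addSn subnKC // count_size.
Qed.

Lemma word_map (f : nat -> nat) w :
  {in w &, {mono f : x y / x < y}} -> word (map f w) = word w.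
Proof.
elim: w => //= x w IH fP; rewrite IH.
  congr (cmp _ (cyc _)); rewrite count_map; apply: eq_in_count => y yw /=.
  by rewrite fP // ?mem_head // in_cons yw orbT.
by move=> y z yw zw; rewrite fP // in_cons ?yw ?zw orbT.
Qed.

Lemma word_addn c w : word (map (addn c) w) = word w.
Proof. by apply: word_map => x y _ _; rewrite ltn_add2l. Qed.

(** Letters of [v] are never smaller than those of [u], so they add nothing to the codes in [u]. *)
Lemma word_cat u v : allrel leq u v ->
  word (u ++ v) = cmp (shn (size u) (word v)) (word u).
Proof.
elim: u => [|x u IH] /=; first by rewrite cmpx1.
move=> /andP[xv uv]; rewrite IH // sh_cmp cmpA count_cat.
rewrite [count _ v](_ : _ = 0) ?addn0 //.
apply/eqP; rewrite -leqn0 leqNgt -has_count -all_predC.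
by apply: sub_all xv => y /=; rewrite -leqNgt.
Qed.

Lemma word_sorted w : sorted leq w -> word w = cI.
Proof.
elim: w => //= x w IH xw.
rewrite (IH (path_sorted xw)) sh1 cmp1x (_ : count _ _ = 0) ?cyc0 //.
apply/eqP; rewrite -leqn0 leqNgt -has_count -all_predC.
have := order_path_min leq_trans xw.
by apply: sub_all => y /=; rewrite -leqNgt.
Qed.

(** Letters before the pair keep their codes. At the head, the ascending case is [cyc_swap] and the
    other follows from C ∘ C = I. *)
Lemma word_swap u (x y : nat) v : x != y ->
  word (u ++ y :: x :: v) = cmp (shn (size u) cC) (word (u ++ x :: y :: v)).
Proof.
move=> nxy; elim: u => [|z u IH]; last first.
  rewrite /= IH sh_cmp cmpA !count_cat /=.
  by congr (cmp _ (cmp _ (cyc (_ + _)))); rewrite addnCA.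
rewrite !cat0s shn0.
have swap (a b : nat) : a < b ->
    word (b :: a :: v) = cmp cC (word (a :: b :: v)).
  move=> ab; rewrite /= ab ltnNge (ltnW ab) add0n add1n.
  have le : count (ltn^~ a) v <= count (ltn^~ b) v.
    by apply: sub_count => i /= /ltn_trans; apply.
  rewrite !sh_cmp !cmpA -(cyc_swap le) -!cmpA; congr cmp; congr cmp.
  by rewrite C_sh2.
have [xy|yx|exy] := ltngtP x y; last by rewrite exy eqxx in nxy.
  exact: swap.
by rewrite [in RHS]swap // CCK.
Qed.

(** In a sorted [u] only letters of [v] are counted, so every letter of [u] has code [m]. *)
Lemma word_const_block u v m :
  sorted leq u -> {in u, forall x : nat, count (ltn^~ x) v = m} ->
  word (u ++ v) = cmp (shn (size u) (word v)) (block_cyc (size u) m).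
Proof.
elim: u => [|x u IH] /=; first by rewrite block_cyc0 cmpx1.
move=> xu um; rewrite IH ?(path_sorted xu) //; last first.
  by move=> y yu; apply: um; rewrite in_cons yu orbT.
rewrite block_cycS sh_cmp cmpA count_cat um ?mem_head // (_ : count _ u = 0) //.
apply/eqP; rewrite -leqn0 leqNgt -has_count -all_predC.
have := order_path_min leq_trans xu.
by apply: sub_all => y /=; rewrite -leqNgt.
Qed.

(** * The equivariance laws on words *)

Section Blocks.
Variables (T : eqType) (g : T -> A) (k off v : T -> nat).
Hypothesis gP : forall i, arr (k i) 1 (g i).
Hypothesis offP : forall i j, v i < v j -> off i + k i <= off j.

(** Outer equivariance, each letter [i] being blown up to a block of [k i] consecutive letters. By
    induction on [w], whose head is taken out of the increasing list [l]. *)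
Lemma tens_word_outer w l :
  perm_eq w l -> pairwise (fun i j => v i < v j) l ->
  cmp (tens g w) (word (map v w)) =
  cmp (word (flatten (map (fun i => iota (off i) (k i)) w))) (tens g l).
Proof.
elim: w l => [|i w IH] l; first by rewrite perm_sym => /perm_nilP ->.
move=> wl; have il : i \in l by rewrite -(perm_mem wl) mem_head.
case/splitPr: il wl => l1 l2.
rewrite perm_sym -[i :: l2]cat1s perm_catCA perm_cons perm_sym cat1s => wl.
rewrite pairwise_cat allrel_consr pairwise_cons.
case/and4P=> /andP[l1i l12] pl1 il2 pl2.
have pl : pairwise (fun i j => v i < v j) (l1 ++ l2).
  by rewrite pairwise_cat l12 pl1.
(* The letters below the head are those of [l1], which gives its code. *)
have cI' : count (ltn^~ (v i)) (map v w) = size l1.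
  rewrite count_map (seq.permP wl) count_cat (_ : count _ l2 = 0) ?addn0.
    by apply/eqP; rewrite -all_count.
  apply/eqP; rewrite -leqn0 leqNgt -has_count -all_predC.
  by apply: sub_all il2 => j /= /ltnW; rewrite -leqNgt.
(* A letter of the head block exceeds all letters in the blocks of [l1] and none in those of
   [l2]. *)
have cB' : {in iota (off i) (k i), forall y : nat, count (ltn^~ y)
    (flatten (map (fun i => iota (off i) (k i)) w)) = sumn (map k l1)}.
  move=> y; rewrite mem_iota => /andP[iy yi].
  rewrite count_flatten -map_comp (perm_sumn (perm_map _ wl)) map_cat sumn_cat.
  rewrite [X in _ + X](_ : _ = 0) ?addn0.
    congr sumn; apply/eq_in_map => j jl /=.
    rewrite -[RHS](size_iota (off j)); apply/eqP; rewrite -all_count.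
    apply/allP => z; rewrite mem_iota /= => /andP[_ zj].
    apply: (leq_trans zj); apply: leq_trans iy; apply: offP.
    exact: (allP l1i).
  elim: l2 il2 {l12 pl2 pl wl} => //= j l2 IHl /andP[ij /IHl ->].
  rewrite addn0; apply/eqP; rewrite -leqn0 leqNgt -has_count -all_predC.
  apply/allP => z; rewrite mem_iota /= -leqNgt => /andP[jz _].
  by apply: ltnW; apply: leq_trans yi _; apply: leq_trans jz; apply: offP.
rewrite [map v _]/= word_cons cI' [flatten _]/=.
rewrite (word_const_block (iota_sorted _ _) cB') size_iota.
rewrite tens_cons !cmpA -[cmp (sh (tens _ _)) _]cmpA -sh_cmp (IH _ wl pl).
set X := word (flatten _); set L1 := tens g l1; set L2 := tens g l2.
rewrite !tens_cat tens_cons shn_cmp -shnSr -/L1 -/L2.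
(* Together with [op_cyc], these commutations bring [g i] from the front of the row to its place
   after [L1]. *)
have e1 : cmp (g i) (sh X) = cmp (shn (k i) X) (g i) := arr_sh X (gP i).
have e2 : cmp (sh L1) (cyc (size l1)) = cmp (cyc (sumn (map k l1))) L1.
  exact: (sh_tens_cyc gP).
have e3 := arr_sh L2 (arr_cyc (size l1)).
have e4 : cmp L1 (shn (size l1) (g i)) = cmp (shn (sumn (map k l1)) (g i)) L1.
  exact: arr_sh (arr_tens gP _).
rewrite !sh_cmp -shnS !cmpA -e3 -[cmp (sh L1) _]cmpA e2 -[cmp (g i) _]cmpA e1.
rewrite !cmpA -[cmp (g i) (cmp (cyc _) _)]cmpA (op_cyc _ (gP i)) !cmpA.
by rewrite -[cmp (shn _ (g i)) _]cmpA -e4 !cmpA.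
Qed.

(** Inner equivariance: the blocks occupy increasing intervals, so [word_cat] splits the word and
    each factor slides to its own operation. *)
Lemma tens_word_inner (u : T -> seq nat) l :
  (forall i, size (u i) = k i) -> (forall i, all (ltn^~ (k i)) (u i)) ->
  pairwise (fun i j => v i < v j) l ->
  tens (fun i => cmp (word (u i)) (g i)) l =
  cmp (word (flatten (map (fun i => map (addn (off i)) (u i)) l))) (tens g l).
Proof.
move=> us uk; elim: l => [|i l IH]; first by rewrite cmp1x.
move=> /= /andP[il /IH ->].
rewrite word_cat; last first.
  apply/allrelP => x y /mapP[x' x'u ->] /flatten_mapP[j jl /mapP[y' y'u ->]].
  apply: leq_trans (leq_addr _ _).
  apply: leq_trans (offP (allP il _ jl)).
  by rewrite leq_add2l; apply: ltnW; apply: (allP (uk i)).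
rewrite size_map word_addn us sh_cmp !cmpA -[cmp (g i) _]cmpA.
rewrite (arr_sh (word _) (gP i)) !cmpA -[LHS]cmpA -[RHS]cmpA; congr cmp.
by have := arr_word (u i); rewrite us; apply: arr_sh.
Qed.

End Blocks.

End BciCalculus.

Arguments pw {A} n.
Arguments cyc {A} k.
Arguments word {A} w.

(** * The internal operad *)

Section BlockEnumeration.
Variables (n : nat) (k : 'I_n -> nat).

Definition block_off (i : 'I_n) : nat := \sum_(j < n | j < i) k j.

Lemma block_offP (i j : 'I_n) : i < j -> block_off i + k i <= block_off j.
Proof.
move=> ij; rewrite /block_off [leqRHS](bigID [pred h : 'I_n | h < i]) /=.
apply: leq_add; last by rewrite (bigD1 i) ?ij ?ltnn //= leq_addr.
by rewrite [leqRHS](eq_bigl [pred h : 'I_n | h < i]) // => h /=;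
  case: (ltnP h i) => hi; rewrite ?andbF // (ltn_trans hi ij).
Qed.

Lemma enum_pairwise_ltn m : pairwise (fun i j : 'I_m => i < j) (enum 'I_m).
Proof.
rewrite -(pairwise_map val ltn) val_enum_ord -(sorted_pairwise ltn_trans).
exact: iota_ltn_sorted.
Qed.

(** Both lists are strictly increasing and contain every position. *)
Lemma enum_tagnat : enum 'I_(\sum_i k i) =
  flatten [seq [seq @tagnat.Rank n k i j | j <- enum 'I_(k i)]
          | i <- enum 'I_n].
Proof.
pose r := fun x y : 'I_(\sum_i k i) => x < y.
have rt : transitive r by move=> y x z; apply: ltn_trans.
apply: (irr_sorted_eq rt) => [x||| x]; first exact: ltnn.
- by rewrite (sorted_pairwise rt); apply: enum_pairwise_ltn.
- rewrite (sorted_pairwise rt).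
  elim: (enum 'I_n) (enum_pairwise_ltn n) => //= i l IH /andP[il /IH pl].
  rewrite pairwise_cat pl andbT; apply/andP; split.
    apply/allrelP => x y /mapP[a _ ->] /flatten_mapP[j jl /mapP[b _ ->]].
    rewrite /r !tagnat.RankEsum; apply: leq_trans (leq_addr _ _).
    apply: leq_trans (block_offP (allP il _ jl)); rewrite ltn_add2l.
    exact: ltn_ord.
  rewrite pairwise_map; apply: sub_pairwise (enum_pairwise_ltn _) => a b ab.
  by rewrite /= /r !tagnat.RankEsum ltn_add2l.
rewrite mem_enum; apply/esym/flatten_mapP; exists (tagnat.sig1 x).
  by rewrite mem_enum.
by apply/mapP; exists (tagnat.sig2 x); rewrite ?mem_enum ?tagnat.sig2K.
Qed.

Lemma map_enum_tagnat (T : Type) (F : {i : 'I_n & 'I_(k i)} -> T) :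
  [seq F (Tagged _ (tagnat.sig2 x)) | x <- enum 'I_(\sum_i k i)] =
  flatten [seq [seq F (Tagged _ j) | j <- enum 'I_(k i)] | i <- enum 'I_n].
Proof.
rewrite enum_tagnat map_flatten -map_comp; congr flatten.
apply: eq_map => i /=; rewrite -map_comp; apply: eq_map => j /=.
by rewrite -tagnat.sigE12 /tagnat.Rank tagnat.rankK.
Qed.

Lemma sumn_enum : sumn (map k (enum 'I_n)) = \sum_i k i.
Proof. by rewrite sumnE big_map big_enum. Qed.

Lemma block_word (s : 'S_n) :
  [seq val (block_perm k s x) | x <- enum 'I_(\sum_i k i)] =
  flatten [seq iota (\sum_(j < n | j < i) k (s^-1%g j)) (k (s^-1%g i))
          | i : 'I_n <- [seq s i | i <- enum 'I_n]].
Proof.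
pose F (u : {i : 'I_n & 'I_(k i)}) :=
  \sum_(j < n | j < s (tag u)) k (s^-1%g j) + tagged u.
rewrite (eq_map (g := fun x => F (Tagged _ (tagnat.sig2 x)))); last first.
  by move=> x; rewrite permE; apply: tagnat.RankEsum.
rewrite map_enum_tagnat -[in RHS]map_comp; congr flatten; apply: eq_map => i /=.
rewrite permK -[in RHS](addn0 (\sum_(j < n | _) _)) iotaDl -val_enum_ord.
by rewrite -[in RHS]map_comp.
Qed.

Lemma sum_word (t : forall i, 'S_(k i)) :
  [seq val (sum_perm t x) | x <- enum 'I_(\sum_i k i)] =
  flatten [seq [seq block_off i + y
               | y <- [seq val (t i j) | j <- enum 'I_(k i)]]
          | i <- enum 'I_n].
Proof.
pose F (u : {i : 'I_n & 'I_(k i)}) :=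
  block_off (tag u) + t (tag u) (tagged u).
rewrite (eq_map (g := fun x => F (Tagged _ (tagnat.sig2 x)))); last first.
  by move=> x; rewrite permE; apply: tagnat.RankEsum.
rewrite map_enum_tagnat; congr flatten; apply: eq_map => i /=.
by rewrite -[in RHS]map_comp.
Qed.

End BlockEnumeration.

(** Isolates an adjacent pair, outside which the transposition [tperm i j] fixes everything. *)
Lemma split_enum_ord n (i j : 'I_n) : j = i.+1 :> nat ->
  exists u v, [/\ enum 'I_n = u ++ i :: j :: v, size u = i,
    {in u, forall h, h != i /\ h != j} & {in v, forall h, h != i /\ h != j}].
Proof.
move=> ij; exists (take i (enum 'I_n)), (drop j.+1 (enum 'I_n)).
have e : enum 'I_n = take i (enum 'I_n) ++ i :: j :: drop j.+1 (enum 'I_n).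
  rewrite -[LHS](cat_take_drop i); congr (_ ++ _).
  rewrite (drop_nth i) ?size_enum_ord // nth_ord_enum -ij; congr (_ :: _).
  by rewrite (drop_nth i) ?size_enum_ord // nth_ord_enum.
have := enum_uniq 'I_n; rewrite {1}e cat_uniq /= => /and4P[_ h1 h2 h3].
move: h1; rewrite /= !negb_or => /and3P[iu ju _].
split=> //; first by rewrite size_takel // size_enum_ord ltnW.
- by move=> h hu; split; apply: contraTneq hu => ->.
- move: h2 h3; rewrite inE negb_or => /andP[_ iv] /andP[jv _].
  by move=> h hv; split; apply: contraTneq hv => ->.
Qed.

(** * Permutations as elements of the algebra *)

Section PermutationElement.
Variable A : bci_algebra.

Definition perm_elt n (s : 'S_n) : A := word [seq val (s i) | i <- enum 'I_n].

Lemma arr_perm_elt n (s : 'S_n) : arr n n (perm_elt s).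
Proof.
have := arr_word A [seq val (s i) | i <- enum 'I_n].
by rewrite size_map size_enum_ord.
Qed.

Lemma perm_elt1 n : perm_elt (1 : 'S_n)%g = cI.
Proof.
rewrite /perm_elt (eq_map (g := val)); last by move=> i; rewrite perm1.
by rewrite val_enum_ord word_sorted ?iota_sorted.
Qed.

Lemma perm_elt_tpermM n (i j : 'I_n) (s : 'S_n) : j = i.+1 :> nat ->
  perm_elt (tperm i j * s)%g = cmp (shn i cC) (perm_elt s).
Proof.
move=> ij; have [u [v [e su nu nv]]] := split_enum_ord ij.
have nij : s i != s j :> nat.
  by rewrite val_eqE (inj_eq perm_inj) -val_eqE /= ij neq_ltn ltnSn.
rewrite /perm_elt e !map_cat /= !permM tpermL tpermR -su.
rewrite -(size_map (fun x => val (s x))) -word_swap //.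
congr (word (_ ++ _ :: _ :: _)); apply/eq_in_map => h;
  [move=> /nu [hi hj]|move=> /nv [hi hj]];
  by rewrite permM tpermD // eq_sym.
Qed.

(** Adjacent transpositions generate, so [perm_elt_tpermM] suffices. *)
Lemma perm_eltM n (s t : 'S_n) :
  perm_elt (t * s)%g = cmp (perm_elt t) (perm_elt s).
Proof.
elim/(@perm_adjacent_ind n): t s => [s|t t' IH IH' s|i j ij s].
- by rewrite mul1g perm_elt1 cmp1x.
- by rewrite -mulgA !IH IH' cmpA.
- rewrite perm_elt_tpermM // -[tperm i j]mulg1 perm_elt_tpermM //.
  by rewrite perm_elt1 cmpx1.
Qed.

Lemma perm_elt_tperm n (i j : 'I_n) : j = i.+1 :> nat ->
  perm_elt (tperm i j) = shn i cC.
Proof.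
by move=> ij; rewrite -[tperm i j]mulg1 perm_elt_tpermM // perm_elt1 cmpx1.
Qed.

End PermutationElement.

(** * The closed operad structure *)

Section InternalStructure.
Variable A : bci_algebra.

Lemma arr_car m (x : internal_car A m) : arr m 1 (sval x).
Proof. by case: x => _ /= [a ->]; rewrite -pwE; apply: arr_op. Qed.

Lemma op_car_proof m (x : A) : arr m 1 x -> exists a : A, x = bullet a ∘ Bpow m.
Proof. by move=> /arr_opE ->; exists (x · cI); rewrite pwE. Qed.

Definition op_car m (x : A) (ax : arr m 1 x) : internal_car A m :=
  exist _ x (op_car_proof ax).

Lemma tot_car m n (x : internal_car A m) (y : internal_car A n) :
  m = n -> sval x = sval y -> tot x = tot y.
Proof. by move=> e; case: n / e y => y /sval_inj ->. Qed.

Lemma sval_opcast m n (e : m = n) (x : internal_car A m) :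
  sval (opcast e x) = sval x.
Proof. by case: n / e. Qed.

Definition tsval (f : total (internal_car A)) : A := sval (tagged f).

Lemma arr_tsval f : arr (tag f) 1 (tsval f).
Proof. exact: arr_car. Qed.

Definition car_id : internal_car A 1 := op_car (arr_id A 1).
Definition car_app : internal_car A 2 := op_car (arr_B A).

Lemma arr_car_comp n (g : internal_car A n)
    (f : 'I_n -> total (internal_car A)) :
  arr (\sum_i tag (f i)) 1 (cmp (tens (tsval \o f) (enum 'I_n)) (sval g)).
Proof.
apply: arr_cmp (arr_car g).
have := arr_tens (fun i => arr_tsval (f i)) (enum 'I_n).
by rewrite sumn_enum size_enum_ord.
Qed.

Definition car_comp n (g : internal_car A n)
    (f : 'I_n -> total (internal_car A)) : internal_car A (\sum_i tag (f i)) :=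
  op_car (arr_car_comp g f).

Definition car_act n (f : internal_car A n) (s : 'S_n) : internal_car A n :=
  op_car (arr_cmp (arr_perm_elt A s) (arr_car f)).

Definition car_lam n (p : internal_car A n.+1) : internal_car A n :=
  op_car (arr_op (sval p · cI) n).

Definition car_ops : operad_ops :=
  OperadOps car_id car_comp car_act car_app car_lam.

Lemma car_compE n (g : internal_car A n)
    (f : 'I_n -> total (internal_car A)) :
  sval (car_comp g f) = \big[(fun x y : A => x ∘ y)/sval g]_(i < n)
    (Bpow i · sval (tagged (f i))).
Proof.
(* The starting index [c] is general because the induction passes to tails of the enumeration. *)
have big_tens c (l : seq 'I_n) : map val l = iota c (size l) ->
    \big[(fun x y : A => x ∘ y)/sval g]_(i <- l) (Bpow i · sval (tagged (f i)))
    = cmp (shn c (tens (tsval \o f) l)) (sval g).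
  elim: l c => [|i l IH] c; first by rewrite big_nil shn_id cmp1x.
  case=> ec /IH el; rewrite big_cons el -/(cmp _ _) -pwE pw_app ec.
  by rewrite tens_cons shn_cmp cmpA -shnSr.
have := big_tens 0 (enum 'I_n).
rewrite size_enum_ord val_enum_ord => /(_ erefl).
rewrite -[sval (car_comp g f)]/(cmp (tens (tsval \o f) (enum 'I_n)) (sval g)).
have -> : index_enum 'I_n = enum 'I_n by rewrite [index_enum _]unlock enumT.
by move=> ->.
Qed.

Lemma sval_ocomp2 m n (g : internal_car A 2) (a : internal_car A m)
    (b : internal_car A n) :
  sval (@ocomp2 car_ops m n g a b) =
  cmp (sval a) (cmp (sh (sval b)) (sval g)).
Proof.
by rewrite /ocomp2 sval_opcast /= !enum_ordSl enum_ord0 /= sh1 cmpx1 cmpA.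
Qed.

Lemma car_closed : closed_symmetric_operad_axioms car_ops.
Proof.
split.
- move=> m f; apply: tot_car; first by rewrite big_ord1.
  by rewrite /= enum_ordSl enum_ord0 /= sh1 !cmpx1.
- move=> n f; apply: tot_car; first by rewrite /= sum1_card card_ord.
  rewrite /= (_ : tens _ _ = cI) ?cmp1x //.
  by elim: (enum _) => //= i l ->; rewrite cmp1x sh1.
(* Associativity: the inputs listed block by block form a flattened list, to which [tens_flatten]
   applies. *)
- move=> n h g f.
  pose F i := [seq f i j | j <- enum 'I_(tag (g i))].
  have eF : [seq f (tagnat.sig1 x) (tagnat.sig2 x)
      | x <- enum 'I_(\sum_i tag (g i))] = flatten (map F (enum 'I_n)).
    exact: (map_enum_tagnat (fun u => f (tag u) (tagged u))).
  apply: tot_car => /=.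
    rewrite -[LHS]sumn_enum -[RHS]sumn_enum.
    rewrite (map_comp (@tag _ _)) eF map_flatten sumn_flatten -!map_comp.
    congr sumn; apply: eq_map => i /=.
    by rewrite -sumn_enum -map_comp.
  rewrite -tens_map eF -cmpA; congr cmp.
  rewrite (@tens_flatten _ _ tsval _ F (tsval \o g)); last first.
    by move=> i; rewrite size_map size_enum_ord; apply: arr_tsval.
  by apply: eq_in_tens => i _; rewrite /= tens_map.
- by move=> n f; apply: sval_inj; rewrite /= perm_elt1 cmp1x.
- by move=> n f s t; apply: sval_inj; rewrite /= perm_eltM cmpA.
(* Here [w] lists the values of [s], [l] is the increasing enumeration, and the operations are
   reindexed by the inverse of [s]. *)
- move=> n f s g; apply: sval_inj; rewrite /= sval_opcast /=.
  rewrite /perm_elt block_word -!cmpA; congr cmp.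
  have := @tens_word_outer A _ (fun i => tsval (g (s^-1%g i)))
    (fun i => tag (g (s^-1%g i))) (block_off (fun i => tag (g (s^-1%g i))))
    val (fun i => arr_tsval _) (@block_offP _ _) [seq s i | i <- enum 'I_n]
    (enum 'I_n).
  move=> <-; last exact: enum_pairwise_ltn.
    rewrite (map_comp val s) [in RHS]tens_map; congr cmp.
    by apply: eq_in_tens => i _ /=; rewrite permK.
  apply: uniq_perm; rewrite ?enum_uniq ?(map_inj_uniq perm_inj) ?enum_uniq //.
  move=> i; rewrite mem_enum; apply/mapP; exists (s^-1%g i); rewrite ?permKV //.
  by rewrite mem_enum.
- move=> n f g t; apply: sval_inj; rewrite /= -cmpA; congr cmp.
  rewrite /perm_elt sum_word.
  rewrite -(@tens_word_inner A _ (tsval \o g) (fun i => tag (g i))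
    (block_off (fun i => tag (g i))) val (fun i => arr_tsval _)
    (@block_offP _ _)
    (fun i => [seq val (t i j) | j <- enum 'I_(tag (g i))])) //.
  + by move=> i; rewrite size_map size_enum_ord.
  + move=> i; apply/allP => x /mapP[j _ ->]; exact: ltn_ord.
  + exact: enum_pairwise_ltn.
- move=> n p; apply: tot_car; first by rewrite addn1.
  rewrite sval_ocomp2 /= sh1 cmp1x cmpA -pwSr.
  by rewrite -(arr_opE (arr_car p)).
(* The hypothesis says q ∘ B = p. At I it reads q I = p I, and [arr_opE] rebuilds [q] from q I. *)
- move=> n p q /(f_equal tsval).
  rewrite /tsval /= sval_ocomp2 /= sh1 cmp1x => e.
  apply: sval_inj; rewrite [LHS](arr_opE (arr_car q)) /= -e cmpE.
  by rewrite (bciBI (bciP A)).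
Qed.

Lemma car_actE n (f : internal_car A n) (i j : 'I_n) : j = i.+1 :> nat ->
  sval (car_act f (tperm i j)) = (Bpow i · cC) ∘ sval f.
Proof. by move=> ij; rewrite /= perm_elt_tperm // -pw_app pwE. Qed.

Definition internal : internal_structure A :=
  @InternalStructure A car_id car_comp car_act car_app car_lam (erefl _)
    car_compE car_actE (erefl _) car_closed.

End InternalStructure.

(** * Linear terms over an operad *)

(** The axioms of an extensional BCI-algebra are what remains of the laws of
    B, C and I when arguments are abstracted. *)
Lemma ext_bci_applicative (A : bci_ops) (T : Type) (app : T -> T -> T)
    (j : A -> T) :
  (forall a b, j (a · b) = app (j a) (j b)) ->
  (forall x y z, app (app (app (j cB) x) y) z = app x (app y z)) ->
  (forall x y z, app (app (app (j cC) x) y) z = app (app x z) y) ->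
  (forall x, app (j cI) x = x) ->
  (forall n a b, (forall l, size l = n ->
     foldl app (j a) l = foldl app (j b) l) -> a = b) ->
  ext_bci A.
Proof.
move=> jM jB jC jI j_inj; pose E := (jB, jC, jI).
split=> [a b c|a b c|a|||||||].
- by apply: (j_inj 0) => [] [|//] _ /=; rewrite !jM !E.
- by apply: (j_inj 0) => [] [|//] _ /=; rewrite !jM !E.
- by apply: (j_inj 0) => [] [|//] _ /=; rewrite !jM !E.
(* The number given to [j_inj] counts the arguments after which both sides rewrite to the same
   term. *)
- by apply: (j_inj 2) => [] [|x [|y [|//]]] //= _; rewrite !jM !E.
- by apply: (j_inj 2) => [] [|x [|y [|//]]] //= _; rewrite !jM !E.
- by apply: (j_inj 4) => [] [|x [|y [|z [|t [|//]]]]] //= _; rewrite !jM !E.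
- by apply: (j_inj 3) => [] [|x [|y [|z [|//]]]] //= _; rewrite !jM !E.
- by apply: (j_inj 4) => [] [|x [|y [|z [|t [|//]]]]] //= _; rewrite !jM !E.
- by apply: (j_inj 4) => [] [|x [|y [|z [|t [|//]]]]] //= _; rewrite !jM !E.
- by apply: (j_inj 4) => [] [|x [|y [|z [|t [|//]]]]] //= _; rewrite !jM !E.
Qed.

Section LabelledOperations.
Variable P : operad.

(** An operation with its inputs labelled. Up to permutation of its inputs this
    is a linear term, in which variables can be substituted and reordered
    without renumbering. *)
Record lop := Lop {
  lar : nat;
  lw : seq nat;
  lop_op : P lar;
  lszP : size lw = lar }.

Lemma nth_map_ord (T : Type) x0 n (F : 'I_n -> T) (i : 'I_n) :
  nth x0 [seq F j | j <- enum 'I_n] i = F i.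
Proof. by rewrite (nth_map i) ?size_enum_ord // nth_ord_enum. Qed.

Lemma map_nth_ord (T : Type) x0 n (w : seq T) : size w = n ->
  [seq nth x0 w i | i : 'I_n <- enum 'I_n] = w.
Proof.
move=> sz; rewrite (map_comp (nth x0 w) val) val_enum_ord -sz.
by rewrite map_nth_iota0 // take_size.
Qed.

Lemma nth_flatten_Rank (T : Type) x0 n (k : 'I_n -> nat) (W : 'I_n -> seq T)
    (i : 'I_n) (j : 'I_(k i)) : (forall i, size (W i) = k i) ->
  nth x0 (flatten (map W (enum 'I_n))) (@tagnat.Rank n k i j) = nth x0 (W i) j.
Proof.
move=> szW; pose F (u : {i : 'I_n & 'I_(k i)}) := nth x0 (W (tag u)) (tagged u).
have -> : map W (enum 'I_n) =
    [seq [seq F (Tagged _ j) | j <- enum 'I_(k i)] | i <- enum 'I_n].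
  by apply: eq_map => h; rewrite /F /= map_nth_ord.
by rewrite -map_enum_tagnat nth_map_ord -tagnat.sigE12 tagnat.rankK.
Qed.

Definition leqv (d d' : lop) : Prop := exists s : 'S_(lar d),
  tot (lop_op d') = tot (oact (lop_op d) s) /\
  lw d' = [seq nth 0 (lw d) (s i) | i <- enum 'I_(lar d)].

Lemma leqv_refl d : leqv d d.
Proof.
exists 1%g; rewrite (oact1 (operadP P)); split=> //.
by under eq_map do rewrite perm1; rewrite map_nth_ord // lszP.
Qed.

Lemma leqv_sym d d' : leqv d d' -> leqv d' d.
Proof.
case: d d' => [n w p sz] [n' w' p' sz'] [s /= [ep ew]].
have en : n = n' := esym (f_equal tag ep).
case: n' / en p' sz' ep => p' sz' ep.
exists s^-1%g => /=; split.
  by rewrite (eq_from_Tagged ep) -(oactM (operadP P)) mulVg (oact1 (operadP P)).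
rewrite ew -[LHS](map_nth_ord 0 sz); apply: eq_map => i.
by rewrite nth_map_ord permKV.
Qed.

Lemma leqv_trans d d' d'' : leqv d d' -> leqv d' d'' -> leqv d d''.
Proof.
case: d d' d'' => [n w p sz] [n' w' p' sz'] [n'' w'' p'' sz''].
move=> [s /= [ep ew]] [t /= [ep' ew']].
have en : n = n' := esym (f_equal tag ep).
case: n' / en p' sz' ep t ep' ew' => p' sz' ep t ep' ew'.
have en : n = n'' := esym (f_equal tag ep').
case: n'' / en p'' sz'' ep' => p'' sz'' ep'.
exists (t * s)%g => /=; split.
  by rewrite (eq_from_Tagged ep') (eq_from_Tagged ep) (oactM (operadP P)).
by rewrite ew' ew; apply: eq_map => i; rewrite nth_map_ord permM.
Qed.

Lemma lcomp_sz n (f : P n) (a : 'I_n -> lop) :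
  size (flatten [seq lw (a i) | i <- enum 'I_n]) = \sum_i lar (a i).
Proof.
rewrite size_flatten /shape -map_comp -sumn_enum; congr sumn.
by apply: eq_map => i /=; rewrite lszP.
Qed.

Definition lcomp n (f : P n) (a : 'I_n -> lop) : lop :=
  @Lop _ _ (ocomp f (fun i => tot (lop_op (a i)))) (lcomp_sz f a).

Lemma lop_eq d d' :
  tot (lop_op d) = tot (lop_op d') -> lw d = lw d' -> d = d'.
Proof.
case: d d' => [n w p sz] [n' w' p' sz'] /= ep ew.
have en : n = n' := f_equal tag ep.
case: n' / en p' sz' ep => p' sz' ep; subst w'.
by rewrite (eq_from_Tagged ep) (eq_irrelevance sz sz').
Qed.

(** By inner equivariance, for permutations chosen for each [i]. *)
Lemma leqv_lcomp n (f : P n) (a b : 'I_n -> lop) :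
  (forall i, leqv (a i) (b i)) -> leqv (lcomp f a) (lcomp f b).
Proof.
move=> ab.
pose s i : 'S_(lar (a i)) := projT1 (cid (ab i)).
have sp i : tot (lop_op (b i)) = tot (oact (lop_op (a i)) (s i)).
  by case: (projT2 (cid (ab i))).
have sw i :
    lw (b i) = [seq nth 0 (lw (a i)) (s i j) | j <- enum 'I_(lar (a i))].
  by case: (projT2 (cid (ab i))).
exists (sum_perm s); split=> /=.
  rewrite -(eqv_inner (operadP P) f (g := fun i => tot (lop_op (a i))) s).
  exact: (f_equal (fun h => tot (ocomp f h)) (funext sp)).
rewrite (eq_map sw).
pose F (u : {i : 'I_n & 'I_(lar (a i))}) :=
  nth 0 (lw (a (tag u))) (s (tag u) (tagged u)).
rewrite -(map_enum_tagnat F); apply: eq_map => x.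
rewrite permE (@nth_flatten_Rank _ 0 _ _ (fun i => lw (a i))) // => i.
exact: lszP.
Qed.

Lemma tot_opcast (T : nat -> Type) m n (e : m = n) (x : T m) :
  tot (opcast e x) = tot x.
Proof. by case: n / e. Qed.

(** By outer equivariance; the labels follow the block permutation. *)
Lemma leqv_lcomp_act n (f : P n) (s : 'S_n) (a : 'I_n -> lop) :
  leqv (lcomp f (fun i => a (s^-1%g i))) (lcomp (oact f s) a).
Proof.
have e := block_sumE (fun i => lar (a i)) s.
have sz : size (lw (lcomp f (fun i => a (s^-1%g i)))) = \sum_i lar (a i).
  by rewrite lszP -e.
have -> : lcomp f (fun i => a (s^-1%g i)) =
    Lop (opcast e (ocomp f (fun i => tot (lop_op (a (s^-1%g i)))))) sz.
  by apply: lop_eq; rewrite //= tot_opcast.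
exists (block_perm (fun i => lar (a i)) s); split=> /=.
  rewrite (eqv_outer (operadP P) f s (fun i => tot (lop_op (a i)))).
  by rewrite (eq_irrelevance e (block_sumE (fun i => lar (a i)) s)).
pose F (u : {i : 'I_n & 'I_(lar (a i))}) := nth 0 (lw (a (tag u))) (tagged u).
have -> : [seq lw (a i) | i <- enum 'I_n] =
    [seq [seq F (Tagged _ j) | j <- enum 'I_(lar (a i))] | i <- enum 'I_n].
  by apply: eq_map => i; rewrite /F /= map_nth_ord // lszP.
rewrite -map_enum_tagnat; apply: eq_map => x; rewrite permE.
rewrite (@nth_flatten_Rank _ 0 _ _ (fun i => lw (a (s^-1%g i)))).
  by rewrite /F /= permK.
by move=> i; apply: lszP.
Qed.

Lemma lcompA n (h : P n) (g : 'I_n -> total P)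
    (f : forall i, 'I_(tag (g i)) -> lop) :
  lcomp (ocomp h g) (fun x => f (tagnat.sig1 x) (tagnat.sig2 x)) =
  lcomp h (fun i => lcomp (tagged (g i)) (f i)).
Proof.
apply: lop_eq => /=.
  exact: (ocompA (operadP P) h (fun i j => tot (lop_op (f i j)))).
rewrite (map_enum_tagnat (fun u => lw (f (tag u) (tagged u)))).
by elim: (enum 'I_n) => //= i l IH; rewrite flatten_cat IH.
Qed.

Lemma tot_ocomp_eq n (f : P n) (a b : 'I_n -> total P) :
  a =1 b -> tot (ocomp f a) = tot (ocomp f b).
Proof. by move=> /funext ->. Qed.

(** * Linear terms and evaluation *)

(** The quotient of [lop] by [leqv], realised as the type of equivalence classes. *)
Definition lterm : Type := {c : lop -> Prop | exists d, c = leqv d}.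

Definition lcls (d : lop) : lterm :=
  exist _ (leqv d) (ex_intro _ d (erefl (leqv d))).

Lemma lcls_eq d d' : leqv d d' -> lcls d = lcls d'.
Proof.
move=> dd'; apply: sval_inj; apply: funext => x /=; apply: propext; split.
  exact: leqv_trans (leqv_sym dd').
exact: leqv_trans dd'.
Qed.

Lemma lcls_leqv d d' : lcls d = lcls d' -> leqv d d'.
Proof. by move=> /(f_equal sval) /= ->; apply: leqv_refl. Qed.

Lemma lcls_surj (q : lterm) : {d | q = lcls d}.
Proof.
apply: cid; case: q => c [d ec]; exists d; apply: sval_inj; exact: ec.
Qed.

Definition lrepr (q : lterm) : lop := projT1 (lcls_surj q).

Lemma lreprK q : lcls (lrepr q) = q.
Proof. by rewrite /lrepr; case: (lcls_surj q). Qed.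

Definition qcomp n (f : P n) (q : 'I_n -> lterm) : lterm :=
  lcls (lcomp f (fun i => lrepr (q i))).

Lemma qcompE n (f : P n) (a : 'I_n -> lop) :
  qcomp f (fun i => lcls (a i)) = lcls (lcomp f a).
Proof.
by apply/lcls_eq/leqv_lcomp => i; apply: lcls_leqv; rewrite lreprK.
Qed.

Lemma qcompA n (h : P n) (g : 'I_n -> total P)
    (q : forall i, 'I_(tag (g i)) -> lterm) :
  qcomp (ocomp h g) (fun x => q (tagnat.sig1 x) (tagnat.sig2 x)) =
  qcomp h (fun i => qcomp (tagged (g i)) (q i)).
Proof.
rewrite (qcompE h (fun i => lcomp (tagged (g i)) (fun j => lrepr (q i j)))).
by rewrite -lcompA.
Qed.

Lemma qcomp_act n (f : P n) (s : 'S_n) (q : 'I_n -> lterm) :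
  qcomp (oact f s) q = qcomp f (fun i => q (s^-1%g i)).
Proof.
apply: esym; apply: lcls_eq.
exact: (leqv_lcomp_act f s (fun i => lrepr (q i))).
Qed.

Lemma qcomp_id (q : 'I_1 -> lterm) : qcomp oid q = q ord0.
Proof.
rewrite -[RHS]lreprK; congr lcls; apply: lop_eq => /=.
  rewrite -[RHS](ocomp_idl (operadP P)).
  apply: (@tot_ocomp_eq 1 oid (fun i => tot (lop_op (lrepr (q i)))) (fun=> _)).
  by move=> i; rewrite (ord1 i).
by rewrite enum_ordSl enum_ord0 /= cats0.
Qed.

Definition lvar (i : nat) : lterm := lcls (@Lop 1 [:: i] oid erefl).

(** Distinct labels force the permutation relating the two labelled operations to be the
    identity. *)
Lemma qcomp_lvar_inj n (p p' : P n) :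
  qcomp p (fun i => lvar i) = qcomp p' (fun i => lvar i) -> p = p'.
Proof.
rewrite !qcompE => /lcls_leqv [s [/= ep ew]].
have wE : flatten [seq [:: val i] | i <- enum 'I_n] = iota 0 n.
  by rewrite flatten_map1 val_enum_ord.
have n1 : \sum_(i < n) 1 = n by rewrite sum1_card card_ord.
have s1 : s = 1%g.
  apply/permP => i; rewrite perm1; apply: val_inj.
  have := f_equal (fun w => nth 0 w i) ew.
  rewrite /= nth_map_ord wE.
  have ltn_n (h : 'I_(\sum_(i < n) 1)) : h < n by rewrite -[leqRHS]n1.
  by rewrite !nth_iota ?ltn_n.
apply/esym/eq_from_Tagged.
move: ep; rewrite s1 (oact1 (operadP P)) => ep.
apply: etrans (esym (ocomp_idr (operadP P) p')) _.
exact: etrans ep (ocomp_idr (operadP P) p).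
Qed.

(** The default [lvar 0] is reached only if [l] is shorter than the arity. *)
Definition qev (f : total P) (l : seq lterm) : lterm :=
  qcomp (tagged f) (fun i => nth (lvar 0) l i).

Lemma qev_ocomp n (f : P n) (a : 'I_n -> total P) (l : 'I_n -> seq lterm) :
  (forall i, size (l i) = tag (a i)) ->
  qev (tot (ocomp f a)) (flatten (map l (enum 'I_n))) =
  qev (tot f) [seq qev (a i) (l i) | i <- enum 'I_n].
Proof.
move=> szl; rewrite /qev /=.
rewrite [in RHS](_ : (fun i => _) = fun i : 'I_n => qev (a i) (l i)).
  2: by apply: funext => i; rewrite nth_map_ord.
rewrite -qcompA; congr qcomp; apply: funext => x.
by rewrite -[x in LHS]tagnat.sig2K nth_flatten_Rank.
Qed.

Lemma qev_ocomp2 m n (g : P 2) (a : P m) (b : P n) l1 l2 :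
  size l1 = m -> size l2 = n ->
  qev (tot (ocomp2 g a b)) (l1 ++ l2) =
  qev (tot g) [:: qev (tot a) l1; qev (tot b) l2].
Proof.
move=> s1 s2; rewrite /ocomp2 tot_opcast.
have := @qev_ocomp 2 g (pair_args (tot a) (tot b))
  (fun i => if i == ord0 then l1 else l2).
rewrite !enum_ordSl enum_ord0 /= cats0 => -> // i.
by rewrite /pair_args; case: ifP.
Qed.

Lemma qev_oid q : qev (tot oid) [:: q] = q.
Proof. exact: qcomp_id. Qed.

Definition qapp (q q' : lterm) : lterm := qev (tot oapp) [:: q; q'].

Lemma qev_olam n (p : P n.+1) l q : size l = n ->
  qev (tot p) (rcons l q) = qapp (qev (tot (olam p)) l) q.
Proof.
move=> sl; rewrite -(olamK (operadP P) p) -cats1 qev_ocomp2 //.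
by rewrite qev_oid.
Qed.

Definition qconst (a : P 0) : lterm := qev (tot a) [::].

Lemma qconst_app (a b : P 0) :
  qconst (ocomp2 oapp a b) = qapp (qconst a) (qconst b).
Proof. exact: (@qev_ocomp2 0 0 oapp a b [::] [::]). Qed.

Lemma qapp_lam (p : P 1) x : qapp (qconst (olam p)) x = qev (tot p) [:: x].
Proof. by rewrite -(@qev_olam 0 p [::]). Qed.

Lemma qev_lam1 (p : P 2) x y :
  qapp (qev (tot (olam p)) [:: x]) y = qev (tot p) [:: x; y].
Proof. by rewrite -(@qev_olam 1 p [:: x]). Qed.

Lemma qev_lam2 (p : P 3) x y z :
  qapp (qev (tot (olam p)) [:: x; y]) z = qev (tot p) [:: x; y; z].
Proof. by rewrite -(@qev_olam 2 p [:: x; y]). Qed.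

Lemma qI x : qapp (qconst (op_I P)) x = x.
Proof. by rewrite qapp_lam qev_oid. Qed.

Lemma qB x y z : qapp (qapp (qapp (qconst (op_B P)) x) y) z = qapp x (qapp y z).
Proof.
rewrite qapp_lam qev_lam1 qev_lam2.
by rewrite (@qev_ocomp2 1 2 oapp oid oapp [:: x] [:: y; z]) // qev_oid.
Qed.

Lemma qC x y z : qapp (qapp (qapp (qconst (op_C P)) x) y) z = qapp (qapp x z) y.
Proof.
rewrite qapp_lam qev_lam1 qev_lam2.
transitivity (qev (tot (ocomp2 oapp oapp oid)) [:: x; z; y]); last first.
  by rewrite (@qev_ocomp2 2 1 oapp oapp oid [:: x; z] [:: y]) // qev_oid.
(* The action permutes arguments by the inverse; a transposition is its own inverse. *)
rewrite /qev [LHS]qcomp_act; congr qcomp; apply: funext => i; rewrite tpermV.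
have [->|n1] := eqVneq i (inord 1); first by rewrite tpermL !inordK.
have [->|n2] := eqVneq i (inord 2); first by rewrite tpermR !inordK.
rewrite tpermD 1?eq_sym //; move: n1 n2; rewrite -!val_eqE /= !inordK //.
by case: i => [[|[|[|i]]] lt].
Qed.

(** The inverse of [n]-fold abstraction. *)
Fixpoint uncurry (a : P 0) n : P n :=
  if n is n'.+1 then opcast (addn1 n') (ocomp2 oapp (uncurry a n') oid) else a.

Lemma olam_uncurry a n : olam (uncurry a n.+1) = uncurry a n.
Proof.
by apply/esym/(olam_uniq (operadP P)); rewrite /= tot_opcast.
Qed.

Lemma uncurry_inj n : injective (uncurry^~ n).
Proof.
elim: n => // n IH a b /(f_equal (@olam P n)).
by rewrite !olam_uncurry => /IH.
Qed.

Lemma qev_uncurry a l :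
  qev (tot (uncurry a (size l))) l = foldl qapp (qconst a) l.
Proof.
elim/last_ind: l => // l q IH.
by rewrite size_rcons (qev_olam _ _ erefl) olam_uncurry IH foldl_rcons.
Qed.

Lemma qev_lvar_inj n (p p' : P n) :
  qev (tot p) [seq lvar i | i <- iota 0 n] =
  qev (tot p') [seq lvar i | i <- iota 0 n] -> p = p'.
Proof.
move=> e; apply: qcomp_lvar_inj; move: e; rewrite /qev /=.
rewrite (_ : (fun i => _) = fun i : 'I_n => lvar i) //; apply: funext => i.
by rewrite (nth_map 0) ?size_iota // nth_iota.
Qed.

(** Uncurrying is injective, and an operation is determined by its value at distinct variables. *)
Lemma qconst_inj n (a b : P 0) :
  (forall l, size l = n -> foldl qapp (qconst a) l = foldl qapp (qconst b) l) ->
  a = b.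
Proof.
move=> e; apply: (@uncurry_inj n); apply: qev_lvar_inj.
have sl : size [seq lvar i | i <- iota 0 n] = n by rewrite size_map size_iota.
by have := e _ sl; rewrite -!qev_uncurry sl.
Qed.

Lemma ext_bci_global : ext_bci (global_ops P).
Proof.
exact: (@ext_bci_applicative (global_ops P) lterm qapp qconst qconst_app qB qC
  qI qconst_inj).
Qed.

End LabelledOperations.

(** * The adjunction *)

Section Unit.
Variable A : bci_algebra.

Lemma car_lam_app n (p : internal_car A n.+1) :
  sval (car_lam p) · cI = sval p · cI.
Proof.
by rewrite /= cmpE pw_app shn_id bulletE (bciI (bciP A)).
Qed.

Definition unit_fun (a : A) : internal_car A 0 := op_car (arr_bullet a).

Lemma unit_fun_app (x : internal_car A 0) : unit_fun (sval x · cI) = x.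
Proof.
by apply: sval_inj; rewrite /= [RHS](arr_opE (arr_car x)) pw0 cmpx1.
Qed.

Lemma unit_fun_lam (p : internal_car A 1) :
  car_lam p = unit_fun (sval p · cI).
Proof. by rewrite -[LHS]unit_fun_app car_lam_app. Qed.

Definition unit_hom :
  bci_hom A (global_ops (internal_operad (internal A))).
Proof.
exists unit_fun => [a b|||].
- apply: sval_inj.
  rewrite [RHS](sval_ocomp2 (car_app A) (unit_fun a) (unit_fun b)) /=.
  by rewrite bullet_app -!cmpA bullet_sh.
(* Abstraction keeps the value at I, so only the body of each combinator is evaluated there. *)
- apply: esym; apply: etrans (unit_fun_lam _) _; rewrite !car_lam_app.
  rewrite (sval_ocomp2 (car_app A) (car_id A) (car_app A)) /= cmp1x cmpE.
  by rewrite (bciBI (bciP A)) shE cmpx1.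
- apply: esym; apply: etrans (unit_fun_lam _) _; rewrite !car_lam_app.
  rewrite [sval _](_ : _ = cmp (sh cC) (cmp cB cB)).
    by rewrite !cmpE !(bciBI (bciP A)) shE cmpx1.
  (* The last two of the three variables are adjacent, so the action composes with B C. *)
  have e : (inord 2 : 'I_3) = (inord 1 : 'I_3).+1 :> nat by rewrite !inordK.
  rewrite [LHS](car_actE _ e) inordK //.
  rewrite (sval_ocomp2 (car_app A) (car_app A) (car_id A)) /= sh1 cmp1x.
  by rewrite -/(cmp cB cI) cmpx1.
- apply: esym; apply: etrans (unit_fun_lam _) _.
  by rewrite /= (bciI (bciP A)).
Defined.

End Unit.

(** * Extending a homomorphism to the internal operad *)

Section Extension.
Variables (A : bci_algebra) (P : operad) (h : bci_hom A (global_ops P)).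

Definition trm (a : A) : lterm P := qconst (h a).

Notation "x @@ y" := (qapp x y) (at level 38, left associativity).

Lemma trmM a b : trm (a · b) = trm a @@ trm b.
Proof. by rewrite /trm bfun_app; apply: qconst_app. Qed.

Lemma trmB x y z : trm cB @@ x @@ y @@ z = x @@ (y @@ z).
Proof. by rewrite /trm bfunB; apply: qB. Qed.

Lemma trmC x y z : trm cC @@ x @@ y @@ z = x @@ z @@ y.
Proof. by rewrite /trm bfunC; apply: qC. Qed.

Lemma trmI x : trm cI @@ x = x.
Proof. by rewrite /trm bfunI; apply: qI. Qed.

Lemma trm_cmp a b x : trm (cmp a b) @@ x = trm a @@ (trm b @@ x).
Proof. by rewrite !trmM trmB. Qed.

Lemma trm_bullet a x : trm (bullet a) @@ x = x @@ trm a.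
Proof. by rewrite !trmM trmC trmI. Qed.

Lemma trm_shn n a x l : size l = n ->
  foldl (@qapp P) (trm (shn n a) @@ x) l = trm a @@ foldl (@qapp P) x l.
Proof.
elim: n x l => [|n IH] x [|q l] //= [sl].
by rewrite trmM trmB IH.
Qed.

(** The value that the image of [f] must take at the terms [l]. *)
Definition ext_val n (f : internal_car A n) (l : seq (lterm P)) : lterm P :=
  foldl (@qapp P) (trm (sval f · cI)) l.

(** As [f] is (f I)• ∘ B^n, it gathers the arguments [l] under f I and passes the result to [x]. *)
Lemma trm_op n (f : internal_car A n) x l : size l = n ->
  foldl (@qapp P) (trm (sval f) @@ x) l = x @@ ext_val f l.
Proof.
move=> sl; rewrite /ext_val.
rewrite {1}(arr_opE (arr_car f)) trm_cmp trm_bullet.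
move: (trm (sval f · cI)) => y {f}.
elim: n x y l sl => [|n IH] x y [|q l] //= sl; first by rewrite pw0 trmI.
by rewrite pwS trm_cmp trmB IH //; case: sl.
Qed.

Lemma ext_valE n (f : internal_car A n) l :
  ext_val f l = foldl (@qapp P) (trm (sval f) @@ trm cI) l.
Proof. by rewrite /ext_val trmM. Qed.

(** Block by block, [trm_op] absorbs [l i] into one argument of [g]. *)
Lemma ext_val_comp n (g : internal_car A n)
    (f : 'I_n -> total (internal_car A)) (l : 'I_n -> seq (lterm P)) :
  (forall i, size (l i) = tag (f i)) ->
  ext_val (car_comp g f) (flatten [seq l i | i <- enum 'I_n]) =
  ext_val g [seq ext_val (tagged (f i)) (l i) | i <- enum 'I_n].
Proof.
move=> sl; rewrite !ext_valE /= trm_cmp.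
elim: (enum 'I_n) (trm (sval g) @@ _) => [|i s IH] x; first by rewrite trmI.
rewrite tens_cons trm_cmp [flatten _]/= foldl_cat trm_op ?sl //.
by rewrite trmM trmB IH.
Qed.

Lemma ext_val_act n (f : internal_car A n) (i j : 'I_n) l : j = i.+1 :> nat ->
  size l = n ->
  ext_val (car_act f (tperm i j)) l =
  ext_val f [seq nth (lvar P 0) l (tperm i j x) | x <- enum 'I_n].
Proof.
move=> ij sl; rewrite -[in LHS](map_nth_ord (lvar P 0) sl).
have [u [v [e su nu nv]]] := split_enum_ord ij.
rewrite [LHS]ext_valE [sval _]/= perm_elt_tperm // trm_cmp.
rewrite !e !map_cat !foldl_cat /= tpermL tpermR.
rewrite trm_shn ?size_map // trmC ext_valE foldl_cat /=.
have fix_tperm w : {in w, forall x, x != i /\ x != j} ->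
    [seq nth (lvar P 0) l (tperm i j x) | x <- w] =
    [seq nth (lvar P 0) l x | x : 'I_n <- w].
  by move=> nw; apply/eq_in_map => x /nw [xi xj]; rewrite tpermD // eq_sym.
by rewrite !fix_tperm.
Qed.

Definition ext_fun n (f : internal_car A n) : P n :=
  uncurry (h (sval f · cI)) n.

Lemma qev_ext_fun n (f : internal_car A n) l : size l = n ->
  qev (tot (ext_fun f)) l = ext_val f l.
Proof. by move=> sl; have := qev_uncurry (h (sval f · cI)) l; rewrite sl. Qed.

Lemma qev_oact n (p : P n) (s : 'S_n) l :
  qev (tot (oact p s)) l =
  qev (tot p) [seq nth (lvar P 0) l (s^-1%g x) | x <- enum 'I_n].
Proof.
rewrite /qev [LHS]qcomp_act; congr qcomp; apply: funext => x.
by rewrite nth_map_ord.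
Qed.

Lemma lvars_blocks n (k : 'I_n -> nat) :
  [seq lvar P i | i <- iota 0 (\sum_i k i)] =
  flatten [seq [seq lvar P (@tagnat.Rank n k i j) | j <- enum 'I_(k i)]
          | i <- enum 'I_n].
Proof.
rewrite -val_enum_ord enum_tagnat !map_flatten -!map_comp; congr flatten.
by apply: eq_map => i /=; rewrite -!map_comp.
Qed.

Let sv n : size [seq lvar P i | i <- iota 0 n] = n.
Proof. by rewrite size_map size_iota. Qed.

Let se (T : Type) n (F : 'I_n -> T) : size [seq F i | i <- enum 'I_n] = n.
Proof. by rewrite size_map size_enum_ord. Qed.

Definition ext_hom : operad_hom (internal_operad (internal A)) P.
Proof.
exists ext_fun => [|n g a|n f s|].
(* Equations between operations are compared at distinct variables, where [ext_val] computes the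
   values. *)
- apply: qev_lvar_inj; rewrite qev_ext_fun //= /ext_val /= (bciI (bciP A)).
  by rewrite trmI qev_oid.
- apply: qev_lvar_inj; rewrite qev_ext_fun //.
  rewrite lvars_blocks ext_val_comp // (@qev_ocomp _ _ _
    (fun i => tot (ext_fun (tagged (a i))))) // qev_ext_fun //.
  by apply: f_equal; apply: eq_map => i; rewrite qev_ext_fun.
- move: s f; apply: perm_adjacent_ind => [f|s t IHs IHt f|i j ij f].
  + by rewrite (oact1 (car_closed A)) (oact1 (operadP P)).
  + by rewrite (oactM (car_closed A)) (oactM (operadP P)) /= IHs IHt.
  + apply: qev_lvar_inj; rewrite qev_ext_fun // ext_val_act // qev_oact tpermV.
    by apply/esym/qev_ext_fun/se.
- apply: qev_lvar_inj; rewrite qev_ext_fun //= /ext_val /= (bciBI (bciP A)).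
  by rewrite trmI.
Defined.

End Extension.

Lemma olam_inj (P : operad) n : injective (@olam P n).
Proof.
move=> p p' e; apply: eq_from_Tagged.
by rewrite -[LHS](olamK (operadP P) p) e (olamK (operadP P) p').
Qed.

(** Uniqueness of the extension: [f] commutes with abstraction, which reduces to arity 0, where the
    unit is surjective. *)
Lemma uncurry_unit (A : bci_algebra) (P : operad)
    (f : operad_hom (internal_operad (internal A)) P) n (x : internal_car A n) :
  uncurry (f 0 (unit_fun (sval x · cI))) n = f n x.
Proof.
elim: n x => [|n IH] x; first by rewrite unit_fun_app.
apply: olam_inj; rewrite olam_uncurry -(car_lam_app x) IH.
exact: (@ofun_lam (internal_operad (internal A)) P f n x).
Qed.

Theorem theorem5p4 :
  exists (S : forall A : bci_algebra, internal_structure A)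
         (ax : forall P : operad, ext_bci (global_ops P)),
    left_adjoint (internal_functor S) (global_functor ax).
Proof.
exists internal, ext_bci_global.
(* The transpose of [f] is its component at arity 0 precomposed with the unit. *)
exists (fun (A : bci_algebra) (P : operad)
    (f : operad_hom (internal_operad (internal A)) P) =>
  bci_comp (global_hom f) (unit_hom A)).
split=> [A P|A' A P u f|A P P' v f].
(* The inverse is [ext_hom]. At arity 0 nothing is uncurried, and a• I = a gives the second
   composite. *)
- exists (@ext_hom A P) => f.
    apply: operad_hom_eq => n x; exact: uncurry_unit.
  apply: bci_hom_eq => a /=.
  by rewrite /ext_fun /= bulletE (bciI (bciP A)).
- apply: bci_hom_eq => a /=; congr (f 0 _); apply: sval_inj => /=.
  by rewrite bfun_bullet.
- by apply: bci_hom_eq.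
Qed.
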